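(* For every $(f,g)\in L^\infty(\Omega)\times L^\infty(\Omega')$, $$\|f\oplus g-f_*\oplus g_*\|_{L^2(P\otimes Q)} \le \gamma_{\varepsilon,\omega}\max\bigl(\|f\oplus g-f_*\oplus g_*\|_\infty,\varepsilon\bigr)\,\|\mathrm{D}\Gamma(f,g)\|_{L^2(P)\times L^2(Q)},$$ and $$\|\mathrm{D}\Gamma(f,g)\|_{L^2(P)\times L^2(Q)}^2 \ge \frac{\mathrm{QOT}_\varepsilon(P,Q)-\Gamma(f,g)}{\gamma_{\varepsilon,\omega}\max\bigl(\|f\oplus g-f_*\oplus g_*\|_\infty,\varepsilon\bigr)},$$ where $$\gamma_{\varepsilon,\omega}=16\,\delta_P^{-1}\min(\varrho_{\varepsilon,\omega},1)^{-d}\,\frac{\Lambda_P^2}{\lambda_P^2}\,\frac{\bigl(\lceil \mathrm{diam}(\Omega)/\varrho_{\varepsilon,\omega}\rceil\bigr)^{d+2}}{\inf_{y\in\Omega'}Q(B_{\varrho_{\varepsilon,\omega}}(y))}.$$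
   Context: Fix $d\ge 1$ and $\varepsilon>0$. $B_r(x)\subset\mathbb{R}^d$ is the open ball of center $x$ and radius $r>0$. $P$ and $Q$ are probability measures on $\mathbb{R}^d$ such that: $P$ has convex, compact support $\Omega$ and a density $\rho=dP/d\mathcal{L}_d$ with respect to Lebesgue measure $\mathcal{L}_d$ with $\lambda_P\le\rho(x)\le\Lambda_P$ for all $x\in\Omega$, for constants $0<\lambda_P<\Lambda_P<\infty$; $Q$ has compact support $\Omega'$. The cost $c:\mathbb{R}^d\times\mathbb{R}^d\to\mathbb{R}$ satisfies $$|c(x,y)-c(x',y')|\le\omega(\|x-x'\|+\|y-y'\|)\quad\text{for all }x,x'\in\Omega,\ y,y'\in\Omega',$$ where $\omega:[0,\infty)\to[0,\infty)$ is a modulus of continuity, i.e., nondecreasing, continuous, with $\omega(0)=0$. $\delta_P\in(0,1]$ is a constant (it exists and depends only on $\Omega$ and $\lambda_P$) such that $P(B_r(x))\ge\delta_P\min(r^d,1)$ for all $r>0$, $x\in\Omega$. Set $R:=\max(1,\mathrm{diam}(\Omega),\mathrm{diam}(\Omega'))$ and $$\varrho_{\varepsilon,\omega}:=\sup\Bigl\{r\in[0,R]: 2\omega(r)+\omega(2r)\le \frac{\varepsilon}{2}\Bigr\}>0.$$ With $\Pi(P,Q)$ the set of couplings of $(P,Q)$, $$\mathrm{QOT}_\varepsilon(P,Q):=\inf_{\pi\in\Pi(P,Q)}\int c\,d\pi+\frac{\varepsilon}{2}\left\|\frac{d\pi}{d(P\otimes Q)}\right\|^2_{L^2(P\otimes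 Q)},$$ the last term being $+\infty$ if $\pi\not\ll P\otimes Q$. The dual objective $\Gamma:L^2(P)\times L^2(Q)\to\mathbb{R}$ is $$\Gamma(f,g):=\int\Big(f(x)+g(y)-\frac{1}{2\varepsilon}\big(f(x)+g(y)-c(x,y)\big)_+^2\Big)\,d(P\otimes Q)(x,y),$$ where $(t)_+=\max(t,0)$. Its gradient is $\mathrm{D}\Gamma(f,g)=(\mathrm{D}_1\Gamma(f,g),\mathrm{D}_2\Gamma(f,g))\in L^2(P)\times L^2(Q)$ with $$\mathrm{D}_1\Gamma(f,g)(x)=1-\frac1\varepsilon\int (f(x)+g(y)-c(x,y))_+\,dQ(y),\qquad \mathrm{D}_2\Gamma(f,g)(y)=1-\frac1\varepsilon\int (f(x)+g(y)-c(x,y))_+\,dP(x).$$ The norm on the product is $\|(u,v)\|^2_{L^2(P)\times L^2(Q)}=\|u\|^2_{L^2(P)}+\|v\|^2_{L^2(Q)}$. Write $(f\oplus g)(x,y):=f(x)+g(y)$. Known facts: strong duality $\mathrm{QOT}_\varepsilon(P,Q)=\sup_{L^2(P)\times L^2(Q)}\Gamma$ holds; maximizers of $\Gamma$ exist and are unique up to $(f_*+a,g_*-a)$, $a\in\mathbb{R}$. The potentials $(f_*,g_* )$ are a fixed (arbitrary) maximizer, with versions $f_*:\Omega\to\mathbb{R}$, $g_*:\Omega'\to\mathbb{R}$ satisfying $|f_*(x)-f_*(x')|\le\omega(\|x-x'\|)$ and $|g_*(y)-g_*(y')|\le\omega(\|y-y'\|)$; they satisfy $\int (f_*(x)+g_*(y)-c(x,y))_+dQ(y)=\varepsilon$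 for all $x\in\Omega$ and $\int (f_*(x)+g_*(y)-c(x,y))_+dP(x)=\varepsilon$ for all $y\in\Omega'$. $L^\infty(\Omega)$, $L^\infty(\Omega')$ are the spaces of bounded measurable functions, and $\|\cdot\|_\infty$ is the sup norm. *)

(* Defs.v *)
From HB Require Import structures.
From mathcomp Require Import all_boot all_order all_algebra.
From mathcomp Require Import all_classical all_reals all_analysis.
From mathcomp Require Import measurable_realfun.

Set Implicit Arguments.
Unset Strict Implicit.
Unset Printing Implicit Defensive.

Import Order.TTheory GRing.Theory Num.Theory.
Import numFieldNormedType.Exports.

Local Open Scope classical_set_scope.
Local Open Scope ring_scope.

(* The library's topology on 'rV[R]_n comes from the sup norm; it is the
   Euclidean topology. *)
HB.instance Definition _ (R : realType) (n : nat) :=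
  @isMeasurable.Build ((@open 'rV[R]_n).-sigma)%mdisp 'rV[R]_n
    <<s (@open 'rV[R]_n) >> (@sigma_algebra0 _ setT _)
    (@sigma_algebraC 'rV[R]_n _) (@sigma_algebra_bigcup _ setT _).

Section lebesgue_rV.
Context {R : realType}.

Definition rV_cons n (p : R * 'rV[R]_n) : 'rV[R]_n.+1 :=
  \row_(i < n.+1) oapp (p.2 ord0) p.1 (unlift ord0 i).

Definition rV_uncons n (x : 'rV[R]_n.+1) : R * 'rV[R]_n :=
  (x ord0 ord0, \row_(i < n) x ord0 (lift ord0 i)).

Lemma rV_consK n : cancel (@rV_cons n) (@rV_uncons n).
Proof.
case=> a v; congr pair; first by rewrite mxE unlift_none.
by apply/rowP => i; rewrite !mxE liftK.
Qed.

Lemma rV_unconsK n : cancel (@rV_uncons n) (@rV_cons n).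
Proof.
move=> x; apply/rowP => i; rewrite mxE.
by case: unliftP => [j|] -> //=; rewrite mxE.
Qed.

Lemma open_measurable_rV n (A : set 'rV[R]_n) : open A -> measurable A.
Proof. exact: sub_sigma_algebra. Qed.

Lemma ball_rVE n (q : 'rV[R]_n) (e : R) : 0 < e ->
  ball q e = [set x : 'rV[R]_n | forall i, `|q ord0 i - x ord0 i| < e].
Proof.
move=> e0; apply/seteqP; split => x /=.
  by move=> [_ qx] i; exact: qx.
by move=> qx; split=> // i j; rewrite ord1; exact: qx.
Qed.

Lemma open_rV_bigcup n (A : set 'rV[R]_n) : open A ->
  A = \bigcup_(p in [set p : 'rV[rat]_n * nat |
        ball (map_mx ratr p.1 : 'rV[R]_n) (p.2.+1%:R^-1) `<=` A])
      ball (map_mx ratr p.1 : 'rV[R]_n) (p.2.+1%:R^-1).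
Proof.
move=> oA; apply/seteqP; split => [x Ax|x [p pA px]]; last exact: pA px.
have /nbhs_ballP[e /= e0 eA] : nbhs x A by move: oA; rewrite openE => /(_ _ Ax).
have [k ke] : exists k : nat, k.+1%:R^-1 < e / 2 :> R.
  have e20 : 0 < e / 2 by rewrite divr_gt0.
  by have [k _ /(_ k (leqnn k))] := near_infty_natSinv_lt (PosNum e20); exists k.
have k0 : 0 < k.+1%:R^-1 :> R by rewrite invr_gt0.
have qP i : exists q : rat, `|ratr q - x ord0 i| < k.+1%:R^-1.
  have /rat_in_itvoo[q] : x ord0 i - k.+1%:R^-1 < x ord0 i + k.+1%:R^-1.
    by rewrite ltrD2l gtrN.
  rewrite in_itv/= => /andP[q1 q2]; exists q.
  by rewrite ltr_norml ltrBrDl q1/= ltrBlDl.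
pose q : 'rV[rat]_n := \row_i sval (cid (qP i)).
have xq : ball (map_mx ratr q : 'rV[R]_n) k.+1%:R^-1 x.
  by rewrite ball_rVE// => i; rewrite !mxE; case: cid.
exists (q, k) => //= y qy; apply: eA.
apply: (@ball_split R 'rV[R]_n (map_mx ratr q)).
  exact/ball_sym/(le_ball (ltW ke)).
exact: (le_ball (ltW ke)).
Qed.

Lemma measurable_rV_cons n : measurable_fun [set: R * 'rV[R]_n] (@rV_cons n).
Proof.
apply: (measurability (@open 'rV[R]_n.+1)) => // _ [A oA <-]; rewrite setTI.
rewrite (open_rV_bigcup oA) preimage_bigcup.
rewrite bigcup_mkcond.
apply: countable_bigcupT_measurable; first exact: countableP.
move=> -[q k] /=; case: ifPn => // _; set e := k.+1%:R^-1.
have e0 : 0 < e :> R by rewrite invr_gt0.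
set qR : 'rV[R]_n.+1 := map_mx ratr q.
rewrite (_ : _ @^-1` _ =
    ball (qR ord0 ord0) e `*` ball (rV_uncons qR).2 e); last first.
  apply/seteqP; split => -[a v] /=.
    rewrite [in X in X -> _]ball_rVE// => h; split.
      by have := h ord0; rewrite /rV_cons mxE unlift_none.
    rewrite ball_rVE// => i; have := h (lift ord0 i).
    by rewrite /rV_cons !mxE liftK.
  rewrite ball_rVE// => -[/= h0 h].
  rewrite ball_rVE// => i; rewrite /rV_cons [X in _ - X]mxE.
  case: unliftP => [j|] -> //=.
  by have := h j; rewrite !mxE.
apply: measurableX; first by apply: open_measurable; exact: ball_open.
by apply: open_measurable_rV; exact: ball_open.
Qed.

Lemma continuous_measurable_rV n (f : 'rV[R]_n -> R) :
  continuous f -> measurable_fun [set: 'rV[R]_n] f.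
Proof.
move=> cf; apply: (measurability _ (RGenOpens.measurableE R)).
move=> _ [_ [a [b ->]] <-]; rewrite setTI; apply: open_measurable_rV.
by apply: open_comp => // *; exact: cf.
Qed.

Lemma measurable_rV_uncons n :
  measurable_fun [set: 'rV[R]_n.+1] (@rV_uncons n).
Proof.
apply/measurable_fun_pairP; split.
  apply: (@continuous_measurable_rV _ (fun x => x ord0 ord0)).
  exact: coord_continuous.
apply: (measurability (@open 'rV[R]_n)) => // _ [A oA <-]; rewrite setTI.
apply: open_measurable_rV; apply: open_comp => // x _.
move=> B /nbhs_ballP[e /= e0 eB]; apply/nbhs_ballP; exists e => //= y.
rewrite ball_rVE// => xy; apply: eB; rewrite ball_rVE// => i.
by rewrite !mxE; exact: xy.
Qed.

Section lebesgue_step.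
Variables (n : nat) (mu : {sigma_finite_measure set 'rV[R]_n -> \bar R}).

Definition lebesgue_step : set 'rV[R]_n.+1 -> \bar R :=
  pushforward (@lebesgue_measure R \x mu)%E (@rV_cons n).

Let step0 : lebesgue_step set0 = 0%E.
Proof. by rewrite /lebesgue_step /pushforward preimage_set0 measure0. Qed.

Let step_ge0 A : (0 <= lebesgue_step A)%E.
Proof. by rewrite /lebesgue_step /pushforward; exact: measure_ge0. Qed.

Let step_semi_sigma_additive : semi_sigma_additive lebesgue_step.
Proof.
move=> F mF tF mUF; rewrite /lebesgue_step /pushforward preimage_bigcup.
have mpre B : measurable B -> measurable (@rV_cons n @^-1` B).
  by move=> mB; rewrite -[X in measurable X]setTI; exact: measurable_rV_cons.
apply: measure_semi_sigma_additive.
- by move=> k; exact: mpre.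
- apply/trivIsetP => i j _ _ ij; rewrite -preimage_setI.
  by move/trivIsetP : tF => /(_ _ _ _ _ ij) ->//; rewrite preimage_set0.
- by rewrite -preimage_bigcup; exact: mpre.
Qed.

HB.instance Definition _ := isMeasure.Build _ _ _ lebesgue_step
  step0 step_ge0 step_semi_sigma_additive.

Let step_sigma_finite : sigma_finite setT lebesgue_step.
Proof.
have /sigma_finiteP[F [TF ndF Foo]] := sigma_finiteT (@lebesgue_measure R).
have /sigma_finiteP[G [TG ndG Goo]] := sigma_finiteT mu.
exists (fun k => @rV_uncons n @^-1` (F k `*` G k)).
  apply/seteqP; split => // x _.
  have [i _ Fx] : (\bigcup_k F k) (rV_uncons x).1 by rewrite -TF.
  have [j _ Gx] : (\bigcup_k G k) (rV_uncons x).2 by rewrite -TG.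
  exists (maxn i j) => //; split.
    by move: Fx; apply/subsetPset/ndF/leq_maxl.
  by move: Gx; apply/subsetPset/ndG/leq_maxr.
move=> k; have [mF Fk] := Foo k; have [mG Gk] := Goo k.
have mFG : measurable (F k `*` G k) by exact: measurableX.
split; first by rewrite -[X in measurable X]setTI; exact: measurable_rV_uncons.
rewrite /lebesgue_step /pushforward -comp_preimage.
rewrite (_ : _ \o _ = id); last by apply/funext => p; exact: rV_consK.
by rewrite preimage_id product_measure1E// lte_mul_pinfty// ge0_fin_numE.
Qed.

HB.instance Definition _ := Measure_isSigmaFinite.Build _ _ _ lebesgue_step
  step_sigma_finite.

End lebesgue_step.

Fixpoint lebesgue_rV n : {sigma_finite_measure set 'rV[R]_n -> \bar R} :=
  match n with
  | 0 => \d_(0 : 'rV[R]_0)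
  | m.+1 => lebesgue_step (lebesgue_rV m)
  end.

Lemma lebesgue_rV_box n (A : 'I_n -> set R) : (forall i, measurable (A i)) ->
  lebesgue_rV n [set x | forall i, A i (x ord0 i)] =
  (\prod_(i < n) lebesgue_measure (A i))%E.
Proof.
have mbox m (B : 'I_m -> set R) : (forall i, measurable (B i)) ->
    measurable [set x : 'rV[R]_m | forall i, B i (x ord0 i)].
  move=> mB.
  rewrite (_ : [set x | _] = \bigcap_i (fun x : 'rV[R]_m => x ord0 i) @^-1` B i).
    apply: fin_bigcap_measurable => // i _.
    rewrite -[X in measurable X]setTI; apply: continuous_measurable_rV => //.
    exact: coord_continuous.
  by apply/seteqP; split => [x h i _|x h i]; [exact: h|exact: (h i I)].
elim: n A => [|n ih] A mA.
  by rewrite big_ord0 /= diracE mem_set// => -[].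
rewrite big_ord_recl /= /lebesgue_step /pushforward.
rewrite (_ : _ @^-1` _ =
    A ord0 `*` [set v : 'rV[R]_n | forall i, A (lift ord0 i) (v ord0 i)]).
  rewrite product_measure1E; [|exact: mA|exact: (mbox n (fun i => A (lift ord0 i)))].
  by congr (_ * _)%E; exact: (ih (fun i => A (lift ord0 i))).
apply/seteqP; split => -[a v] /=.
  move=> h; split; first by have := h ord0; rewrite mxE unlift_none.
  by move=> i; have := h (lift ord0 i); rewrite mxE liftK.
move=> [ha hv] i; rewrite mxE.
by case: unliftP => [j|] -> //=; exact: hv.
Qed.

End lebesgue_rV.

(* The library norm `|x| on 'rV[R]_d is the sup norm. *)
Definition enorm (R : realType) (d : nat) (x : 'rV[R]_d) : R :=
  Num.sqrt (\sum_(i < d) x ord0 i ^+ 2).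

Definition eball (R : realType) (d : nat) (x : 'rV[R]_d) (r : R)
    : set 'rV[R]_d :=
  [set y | enorm (y - x) < r].

Definition ediam (R : realType) (d : nat) (A : set 'rV[R]_d) : R :=
  sup [set enorm (p.1 - p.2) | p in A `*` A].

Definition msupport (R : realType) (d : nat)
    (mu : {measure set 'rV[R]_d -> \bar R}) : set 'rV[R]_d :=
  [set x | forall U : set 'rV[R]_d, open U -> U x -> (0 < mu U)%E].

Definition is_density (R : realType) (d : nat)
    (mu : {measure set 'rV[R]_d -> \bar R}) (rho : 'rV[R]_d -> R) : Prop :=
  [/\ measurable_fun [set: 'rV[R]_d] rho,
      (forall x, 0 <= rho x) &
      forall A, measurable A ->
        mu A = (\int[lebesgue_rV d]_(x in A) (rho x)%:E)%E].

Definition modulus (R : realType) (omega : R -> R) : Prop :=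
  [/\ (forall r, 0 <= r -> 0 <= omega r),
      (forall r s, 0 <= r -> r <= s -> omega r <= omega s),
      {within `[0, +oo[, continuous omega} &
      omega 0 = 0].

Definition cost_modulus (R : realType) (d : nat)
    (Om Om' : set 'rV[R]_d) (c : 'rV[R]_d -> 'rV[R]_d -> R)
    (omega : R -> R) : Prop :=
  forall x x' y y', Om x -> Om x' -> Om' y -> Om' y' ->
    `|c x y - c x' y'| <= omega (enorm (x - x') + enorm (y - y')).

Definition has_modulus (R : realType) (d : nat) (A : set 'rV[R]_d)
    (h : 'rV[R]_d -> R) (omega : R -> R) : Prop :=
  forall x x', A x -> A x' -> `|h x - h x'| <= omega (enorm (x - x')).

(* A function on a measurable set D is represented by a total function; its
   values outside of D are never used. *)

Section function_spaces.
Context (R : realType) (disp : measure_display) (T : measurableType disp).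

Definition L2norm (mu : {measure set T -> \bar R}) (D : set T) (h : T -> R)
    : \bar R :=
  Lnorm mu 2%:E ((EFin \o h) \_ D).

Definition L2fun (mu : {measure set T -> \bar R}) (D : set T) (h : T -> R)
    : Prop :=
  measurable_fun D h /\ (L2norm mu D h < +oo)%E.

Definition Loofun (D : set T) (h : T -> R) : Prop :=
  measurable_fun D h /\ [bounded h x | x in D].

Definition supnorm (D : set T) (h : T -> R) : R := sup [set `|h x| | x in D].

End function_spaces.

Definition osum (R : realType) (d : nat) (f g : 'rV[R]_d -> R)
    (z : 'rV[R]_d * 'rV[R]_d) : R :=
  f z.1 + g z.2.

(* The measures P, Q and P \x Q are carried by the (closed) supports of P and
   Q and by the product of these supports, and the data f, g, c are only
   meaningful there; hence the domains of integration below. *)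

Section qot.
Context (R : realType) (d : nat).
Local Notation Rd := 'rV[R]_d.
Variables (P Q : probability Rd R) (c : Rd -> Rd -> R) (eps : R).

Definition prodP : probability (Rd * Rd)%type R := (P \x Q)%E.

Definition prod_supp : set (Rd * Rd) := msupport P `*` msupport Q.

Definition coupling (pi : probability (Rd * Rd)%type R) : Prop :=
  (forall A, measurable A -> pi (fst @^-1` A) = P A) /\
  (forall A, measurable A -> pi (snd @^-1` A) = Q A).

Definition qot_cost (pi : probability (Rd * Rd)%type R) : \bar R :=
  if `[< pi `<< prodP >] then
    (\int[pi]_(z in prod_supp) (c z.1 z.2)%:E +
     (eps / 2)%:E *
       Lnorm prodP 2%:E (Radon_Nikodym (charge_of_finite_measure pi) prodP)
         ^+ 2)%E
  else +oo%E.

Definition QOT : \bar R := ereal_inf [set qot_cost pi | pi in coupling].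

Definition Gamma (f g : Rd -> R) : R :=
  \int[prodP]_(z in prod_supp)
    (f z.1 + g z.2 -
     (2 * eps)^-1 * Num.max (f z.1 + g z.2 - c z.1 z.2) 0 ^+ 2).

Definition D1Gamma (f g : Rd -> R) (x : Rd) : R :=
  1 - eps^-1 * \int[Q]_(y in msupport Q) Num.max (f x + g y - c x y) 0.

Definition D2Gamma (f g : Rd -> R) (y : Rd) : R :=
  1 - eps^-1 * \int[P]_(x in msupport P) Num.max (f x + g y - c x y) 0.

Definition pair_norm (u v : Rd -> R) : \bar R :=
  ((L2norm P (msupport P) u ^+ 2 + L2norm Q (msupport Q) v ^+ 2) `^ 2^-1)%E.

Definition dual_maximizer (f g : Rd -> R) : Prop :=
  [/\ L2fun P (msupport P) f, L2fun Q (msupport Q) g &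
      forall f' g', L2fun P (msupport P) f' -> L2fun Q (msupport Q) g' ->
        Gamma f' g' <= Gamma f g].

End qot.

Definition scale_bound (R : realType) (d : nat) (Om Om' : set 'rV[R]_d) : R :=
  Num.max 1 (Num.max (ediam Om) (ediam Om')).

Definition varrho (R : realType) (d : nat) (Om Om' : set 'rV[R]_d)
    (omega : R -> R) (eps : R) : R :=
  sup [set r | 0 <= r <= scale_bound Om Om' /\
               2 * omega r + omega (2 * r) <= eps / 2].

Definition gamma_const (R : realType) (d : nat) (P Q : probability 'rV[R]_d R)
    (omega : R -> R) (eps lambda Lambda delta : R) : R :=
  let r := varrho (msupport P) (msupport Q) omega eps in
  16 * delta^-1 * Num.min r 1 ^- d * (Lambda ^+ 2 / lambda ^+ 2) *
  ((Num.ceil (ediam (msupport P) / r))%:~R ^+ (d + 2) /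
   inf [set fine (Q (eball y r)) | y in msupport Q]).

(* Main.v *)
Require Import Defs.
From HB Require Import structures.
From mathcomp Require Import all_boot all_order all_algebra.
From mathcomp Require Import all_classical all_reals all_analysis.
From mathcomp Require Import ring lra measurable_realfun.

(** Write Om, Om' for the supports of P and Q, xi(f, g) = f (+) g - c, and
J = 1 - (xi(f, g))_+ / eps for the density of the gradient of Gamma at (f, g);
Js is the same density at the potentials (fs, gs).  Put u = f - fs,
v = g - gs, and D = u (+) v.

Perturbing the maximizer (fs, gs) by bounded functions shows that Js
is orthogonal to every a (+) b ([first_order]).  Consequently every x in Om
has some y in Om' with xi(fs, gs)(x, y) >= eps, and conversely
([row_slack_ge], [column_slack_ge]); by the moduli of continuity and the
choice of the radius r = varrho, the set W where xi(fs, gs) >= eps / 2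
contains the part in Om x Om' of the product of the r-balls around x and y.

On W the positive part is strongly monotone at the scale
M = max(sup |D|, eps), which gives
- int J D >= (2 M)^-1 int_W D^2.

The Poincare inequality [poincare_osum] bounds int D^2 by C int_W D^2: two
points x, x' of Om at distance at most r see a common ball of points y, so
q (u(x) - u(x'))^2 <= 2 (F(x) + F(x')) where F(x) is the integral of D^2 over
the slice of W at x and q = inf Q(B_r); arbitrary points are joined by
N = ceil(diam / r) steps of a segment, and the average of F at an intermediate
point of the segment is controlled by the density bounds and the scaling of
Lebesgue measure ([segment_average]).  This controls the variance of u; then v
is controlled by averaging over a ball of x.

Finally - int J D is the pairing of the gradient with (u, v), and the shift
(u - a, v + a), with a the mean of u, makes the L2 norm of u (+) v equal to the
norm of the pair (u, v).  Young's inequality turns the bounds above into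
int D^2 <= K^2 |DGamma|^2, and concavity of Gamma into
Gamma(fs, gs) - Gamma(f, g) <= K |DGamma|^2.  The second assertion follows
from QOT <= Gamma(fs, gs), obtained by testing the primal problem with the
coupling of density (xi(fs, gs))_+ / eps ([QOT_le_Gamma]). *)

Set Implicit Arguments.
Unset Strict Implicit.
Unset Printing Implicit Defensive.

Import Order.TTheory GRing.Theory Num.Theory.
Import numFieldNormedType.Exports.

Local Open Scope classical_set_scope.
Local Open Scope ring_scope.

(** * Bounded measurable functions and their integrals *)

Section bounded_measurable.
Context (R : realType) (disp : measure_display) (T : measurableType disp).
Implicit Types (A : set T) (f g : T -> R).

(** Functions that are measurable and bounded on [A]; nothing is required outside
[A].  They are integrable on [A] for every probability, and all the functions
integrated below are of this kind. *)
Definition bmeas A f :=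
  measurable_fun A f /\ exists M : R, forall x, A x -> `|f x| <= M.

Lemma bmeas_cst A (k : R) : bmeas A (fun=> k).
Proof. by split; [exact: measurable_cst|exists `|k|]. Qed.

Lemma bmeasD A f g : bmeas A f -> bmeas A g -> bmeas A (fun x => f x + g x).
Proof.
move=> [mf [M fM]] [mg [N gN]]; split; first exact: measurable_funD.
exists (M + N) => x Ax; rewrite (le_trans (ler_normD _ _))// lerD//.
  exact: fM.
exact: gN.
Qed.

Lemma bmeasM A f g : bmeas A f -> bmeas A g -> bmeas A (fun x => f x * g x).
Proof.
move=> [mf [M fM]] [mg [N gN]]; split; first exact: measurable_funM.
exists (M * N) => x Ax; rewrite normrM ler_pM//.
  exact: fM.
exact: gN.
Qed.

Lemma bmeasN A f : bmeas A f -> bmeas A (fun x => - f x).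
Proof.
move=> bf; rewrite (_ : (fun _ => _) = (fun x => -1 * f x)).
  exact: bmeasM (bmeas_cst _ _) bf.
by apply/funext => x; rewrite mulN1r.
Qed.

Lemma bmeasB A f g : bmeas A f -> bmeas A g -> bmeas A (fun x => f x - g x).
Proof. by move=> bf /bmeasN; exact: bmeasD. Qed.

Lemma bmeasX A f n : bmeas A f -> bmeas A (fun x => f x ^+ n).
Proof.
move=> bf; elim: n => [|n ih]; first exact: bmeas_cst.
under eq_fun do rewrite exprS.
exact: bmeasM.
Qed.

Lemma bmeas_sum A n (F : 'I_n -> T -> R) : (forall i, bmeas A (F i)) ->
  bmeas A (fun x => \sum_(i < n) F i x).
Proof.
move=> bF; elim: n F bF => [|n ih] F bF.
  by under eq_fun do rewrite big_ord0; exact: bmeas_cst.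
under eq_fun do rewrite big_ord_recr /=.
by apply: bmeasD => //; exact: ih.
Qed.

Lemma bmeas_max0 A f : bmeas A f -> bmeas A (fun x => Num.max (f x) 0).
Proof.
move=> [mf [M fM]]; split.
  by apply: measurable_funrpos.
exists M => x Ax; have := fM _ Ax; case: (lerP (f x) 0) => // _.
by rewrite normr0; apply: le_trans.
Qed.

Lemma bmeasS A B f : measurable A -> B `<=` A -> bmeas A f -> bmeas B f.
Proof.
move=> mA BA [mf [M fM]]; split; first exact: measurable_funS mf.
by exists M => x /BA; exact: fM.
Qed.

Lemma eq_bmeas A f g : (forall x, A x -> f x = g x) -> bmeas A f -> bmeas A g.
Proof.
move=> fg [mf [M fM]]; split.
  by apply: eq_measurable_fun mf => x /set_mem; exact: fg.
by exists M => x Ax; rewrite -fg//; exact: fM.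
Qed.

Lemma bmeas_indic A E : measurable E -> bmeas A (\1_E : T -> R).
Proof.
move=> mE; split; first exact: measurable_indic.
by exists 1 => x _; rewrite indicE; case: (_ \in _); rewrite ?normr1 ?normr0.
Qed.

Variables (mu : probability T R) (A : set T) (mA : measurable A).

Lemma bmeas_integrable f : bmeas A f -> mu.-integrable A (EFin \o f).
Proof.
move=> [mf [M fM]]; apply: measurable_bounded_integrable => //.
  by rewrite (le_lt_trans (probability_le1 mu mA))// ltry.
by exists M; split; [exact: num_real|move=> N MN x Ax; exact: le_trans (fM _ Ax)
  (ltW MN)].
Qed.

Lemma intD f g : bmeas A f -> bmeas A g ->
  \int[mu]_(x in A) (f x + g x) = \int[mu]_(x in A) f x + \int[mu]_(x in A) g x.
Proof. by move=> /bmeas_integrable ? /bmeas_integrable ?; rewrite RintegralD. Qed.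

Lemma intB f g : bmeas A f -> bmeas A g ->
  \int[mu]_(x in A) (f x - g x) = \int[mu]_(x in A) f x - \int[mu]_(x in A) g x.
Proof. by move=> /bmeas_integrable ? /bmeas_integrable ?; rewrite RintegralB. Qed.

Lemma intZ (k : R) f : bmeas A f ->
  \int[mu]_(x in A) (k * f x) = k * \int[mu]_(x in A) f x.
Proof. by move=> /bmeas_integrable ?; rewrite RintegralZl. Qed.

Lemma int_sum n (F : 'I_n -> T -> R) : (forall i, bmeas A (F i)) ->
  \int[mu]_(x in A) (\sum_(i < n) F i x) =
  \sum_(i < n) \int[mu]_(x in A) F i x.
Proof.
elim: n F => [|n ih] F bF.
  rewrite big_ord0 -[RHS](mul0r (fine (mu A))) -Rintegral_cst//.
  by apply: eq_Rintegral => x _; rewrite big_ord0.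
rewrite big_ord_recr /= -ih// -intD//; last exact: bmeas_sum.
by apply: eq_Rintegral => x _; rewrite big_ord_recr.
Qed.

Lemma int_le f g : bmeas A f -> bmeas A g -> (forall x, A x -> f x <= g x) ->
  \int[mu]_(x in A) f x <= \int[mu]_(x in A) g x.
Proof. by move=> /bmeas_integrable ? /bmeas_integrable ? ?; rewrite le_Rintegral. Qed.

Lemma eq_int f g : (forall x, A x -> f x = g x) ->
  \int[mu]_(x in A) f x = \int[mu]_(x in A) g x.
Proof. by move=> fg; apply: eq_Rintegral => x /set_mem; exact: fg. Qed.

Lemma EFin_int f : bmeas A f ->
  (\int[mu]_(x in A) f x)%:E = (\int[mu]_(x in A) (f x)%:E)%E.
Proof.
by move=> /bmeas_integrable fi; rewrite /Rintegral fineK// integrable_fin_num.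
Qed.

Lemma int_indic E : measurable E ->
  \int[mu]_(x in A) \1_E x = fine (mu (E `&` A)).
Proof. by move=> mE; rewrite /Rintegral integral_indic. Qed.

Hypothesis A1 : mu A = 1%E.

Lemma int_cst (k : R) : \int[mu]_(x in A) k = k.
Proof. by rewrite Rintegral_cst// [X in fine X]A1 mulr1. Qed.

Lemma probability_setI_full E : measurable E -> mu (E `&` A) = mu E.
Proof.
move=> mE; rewrite [RHS](measureDI mu mE mA) addrC -[LHS]adde0; congr (_ + _)%E.
apply/esym/eqP; rewrite eq_le measure_ge0 andbT.
have <- : mu (~` A) = 0%E by rewrite probability_setC// [X in (1 - X)%E]A1 subee.
apply: le_measure; rewrite ?inE; [exact: measurableD|exact: measurableC|].
by move=> x [].
Qed.

End bounded_measurable.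

Section fubini_bounded.
Context (R : realType) (d1 d2 : measure_display)
  (X : measurableType d1) (Y : measurableType d2).
Variables (P : probability X R) (Q : probability Y R) (A : set X) (B : set Y).
Hypotheses (mA : measurable A) (mB : measurable B).

Lemma bmeas_fst (f : X -> R) : bmeas A f -> bmeas (A `*` B) (fun z => f z.1).
Proof.
move=> [mf [M fM]]; split; last by exists M => -[x y] [/= Ax _]; exact: fM.
move=> mAB E mE.
rewrite (_ : _ `&` _ = (A `&` f @^-1` E) `*` B).
  by apply: measurableX => //; exact: mf.
by apply/seteqP; split => -[x y] /=; rewrite /setX /=; tauto.
Qed.

Lemma bmeas_snd (g : Y -> R) : bmeas B g -> bmeas (A `*` B) (fun z => g z.2).
Proof.
move=> [mf [M fM]]; split; last by exists M => -[x y] [/= _]; exact: fM.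
move=> mAB E mE.
rewrite (_ : _ `&` _ = A `*` (B `&` g @^-1` E)).
  by apply: measurableX => //; exact: mf.
by apply/seteqP; split => -[x y] /=; rewrite /setX /=; tauto.
Qed.

Variable h : X * Y -> R.
Hypothesis bh : bmeas (A `*` B) h.

Lemma bmeas_sec1 x : A x -> bmeas B (fun y => h (x, y)).
Proof.
move=> Ax; have [mh [M hM]] := bh; split; last by exists M => y By; exact: hM.
move=> _ E mE.
have /(measurable_xsection x) := mh (measurableX mA mB) E mE.
congr measurable; apply/seteqP; split => y; rewrite /xsection /= inE /=;
  rewrite /setX /=; tauto.
Qed.

Lemma bmeas_sec2 y : B y -> bmeas A (fun x => h (x, y)).
Proof.
move=> By; have [mh [M hM]] := bh; split; last by exists M => x Ax; exact: hM.
move=> _ E mE.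
have /(measurable_ysection y) := mh (measurableX mA mB) E mE.
congr measurable; apply/seteqP; split => x; rewrite /ysection /= inE /=;
  rewrite /setX /=; tauto.
Qed.

Let k : X * Y -> R := h \_ (A `*` B).

Let mk : measurable_fun setT k.
Proof.
by apply/(measurable_restrictT _ (measurableX mA mB)); case: bh.
Qed.

Let ik : (P \x Q)%E.-integrable setT (EFin \o k).
Proof.
apply: (@bmeas_integrable R _ _ (P \x Q)%E setT) => //; split => //.
have [_ [M hM]] := bh; exists (Num.max M 0) => z _; rewrite /k patchE.
case: ifPn => [/set_mem /hM ?|_]; rewrite ?normr0 le_max ?lexx ?orbT//.
by apply/orP; left.
Qed.

Let k1 x : A x -> \int[Q]_(y in B) h (x, y) = \int[Q]_y k (x, y).
Proof.
move=> Ax; rewrite Rintegral_mkcond; apply: eq_int => // y _.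
rewrite /k !patchE; case: ifPn => [/set_mem By|/negP By].
  by rewrite mem_set.
by case: ifPn => // /set_mem[_ /mem_set].
Qed.

Let k2 y : B y -> \int[P]_(x in A) h (x, y) = \int[P]_x k (x, y).
Proof.
move=> By; rewrite Rintegral_mkcond; apply: eq_int => // x _.
rewrite /k !patchE; case: ifPn => [/set_mem Ax|/negP Ax].
  by rewrite mem_set.
by case: ifPn => // /set_mem[/mem_set].
Qed.

Lemma bmeas_int1 : bmeas A (fun x => \int[Q]_(y in B) h (x, y)).
Proof.
split.
  apply: (@eq_measurable_fun _ _ _ _ _ (fun x => \int[Q]_y k (x, y))).
    by move=> x /set_mem Ax; rewrite k1.
  apply: measurable_funTS; apply: measurableT_comp => //.
  exact: (measurable_fubini_F ik).
have [_ [M hM]] := bh; exists (Num.max M 0) => x Ax.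
apply: (le_trans (le_normr_Rintegral mB (bmeas_integrable Q mB (bmeas_sec1 Ax)))).
have bn : bmeas B (fun y => `|h (x, y)|).
  have [ms [N sN]] := bmeas_sec1 Ax; split; first exact: measurableT_comp.
  by exists N => y By; rewrite normr_id sN.
apply: (@le_trans _ _ (\int[Q]_(y in B) Num.max M 0)).
  apply: int_le => // [|y By]; first exact: bmeas_cst.
  by rewrite le_max hM.
rewrite Rintegral_cst// ler_piMr// ?le_max ?lexx ?orbT//.
rewrite -lee_fin fineK ?probability_le1//.
by rewrite fin_num_measure.
Qed.

Lemma int_fubini1 : \int[(P \x Q)%E]_(z in A `*` B) h z =
  \int[P]_(x in A) \int[Q]_(y in B) h (x, y).
Proof.
rewrite Rintegral_mkcond -/k [RHS]Rintegral_mkcond /Rintegral.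
congr fine; rewrite -(integral12_prod_meas1 ik).
apply: eq_integral => x _; rewrite /fubini_F /= patchE.
case: ifPn => [/set_mem Ax|/negP Ax].
  rewrite -/(Rintegral Q B (fun y => h (x, y))) k1// EFin_int//.
  split; first exact: measurableT_comp.
  have [_ [M hM]] := bh; exists (Num.max M 0) => y _; rewrite /k patchE.
  case: ifPn => [/set_mem /hM ?|_]; rewrite ?normr0 le_max ?lexx ?orbT//.
  by apply/orP; left.
under eq_integral => y _.
  rewrite /k patchE memNset; last by move=> [/mem_set].
  over.
by rewrite integral0.
Qed.

Lemma int_fubini2 : \int[(P \x Q)%E]_(z in A `*` B) h z =
  \int[Q]_(y in B) \int[P]_(x in A) h (x, y).
Proof.
rewrite Rintegral_mkcond -/k [RHS]Rintegral_mkcond /Rintegral.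
congr fine; rewrite -(integral21_prod_meas1 ik).
apply: eq_integral => y _; rewrite /fubini_G /= patchE.
case: ifPn => [/set_mem By|/negP By].
  rewrite -/(Rintegral P A (fun x => h (x, y))) k2// EFin_int//.
  split; first exact: measurableT_comp.
  have [_ [M hM]] := bh; exists (Num.max M 0) => x _; rewrite /k patchE.
  case: ifPn => [/set_mem /hM ?|_]; rewrite ?normr0 le_max ?lexx ?orbT//.
  by apply/orP; left.
under eq_integral => x _.
  rewrite /k patchE memNset; last by move=> [_ /mem_set].
  over.
by rewrite integral0.
Qed.

End fubini_bounded.

Section fubini_swap.
Context (R : realType) (d1 d2 : measure_display)
  (X : measurableType d1) (Y : measurableType d2).
Variables (P : probability X R) (Q : probability Y R) (A : set X) (B : set Y).
Hypotheses (mA : measurable A) (mB : measurable B).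

Lemma bmeas_swap (h : X * Y -> R) : bmeas (A `*` B) h ->
  bmeas (B `*` A) (fun z => h (z.2, z.1)).
Proof.
move=> [mh [M hM]]; split; last by exists M => -[y x] [/= By Ax]; exact: hM.
move=> _ E mE.
have mE' : measurable ((A `*` B) `&` h @^-1` E).
  by apply: mh => //; exact: measurableX.
have : measurable (setT `&` (fun z : Y * X => (z.2, z.1)) @^-1`
    ((A `*` B) `&` h @^-1` E)).
  by apply: measurable_swap.
by congr measurable; apply/seteqP; split => -[y x]; rewrite /setX /=; tauto.
Qed.

Lemma bmeas_int2 (h : X * Y -> R) : bmeas (A `*` B) h ->
  bmeas B (fun y => \int[P]_(x in A) h (x, y)).
Proof. by move=> /bmeas_swap bh; exact: (bmeas_int1 Q P mB mA bh). Qed.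

End fubini_swap.

(** Closure properties of [bmeas], applied structurally; the leaves are constants,
hypotheses, and functions of one coordinate. *)
Ltac bmeas_auto := repeat first
  [ exact: bmeas_cst | eassumption | exact: bmeas_fst | exact: bmeas_snd
  | apply: bmeasX | apply: bmeasB | apply: bmeasD | apply: bmeasM
  | apply: bmeasN | apply: bmeas_max0 ].

(** * Supports, Euclidean balls and moduli of continuity *)

Section support.
Context (R : realType) (d : nat).
Local Notation Rd := 'rV[R]_d.
Implicit Types (mu : {measure set Rd -> \bar R}).

Lemma closed_msupport mu : closed (msupport mu).
Proof.
rewrite -openC openE => x /existsNP[U] /not_implyP[oU] /not_implyP[Ux /negP].
rewrite -leNgt => U0; apply: filterS (open_nbhs_nbhs (conj oU Ux)).
by move=> y Uy Sy; have := Sy U oU Uy; rewrite ltNge U0.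
Qed.

Lemma measurable_msupport mu : measurable (msupport mu).
Proof.
rewrite -[X in measurable X]setCK; apply: measurableC.
by apply: open_measurable_rV; rewrite openC; exact: closed_msupport.
Qed.

Lemma negligible_msupportC mu : mu.-negligible (~` msupport mu).
Proof.
pose B (p : 'rV[rat]_d * nat) : set Rd :=
  ball (map_mx ratr p.1 : Rd) p.2.+1%:R^-1.
pose F k : set Rd := if (unpickle k : option ('rV[rat]_d * nat)) is Some p
  then if mu (B p) == 0%E then B p else set0 else set0.
apply: (@negligibleS _ _ _ _ (\bigcup_k F k)).
  move=> x /= /existsNP[U] /not_implyP[oU] /not_implyP[Ux /negP].
  rewrite -leNgt => U0; move: Ux; rewrite (open_rV_bigcup oU) => -[p pU px].
  exists (pickle p) => //; rewrite /F pickleK ifT//.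
  rewrite eq_le measure_ge0 andbT (le_trans _ U0)//.
  apply: le_measure; rewrite ?inE//; apply: open_measurable_rV => //.
  exact: ball_open.
apply: negligible_bigcup => k; rewrite /F.
case: unpickle => [p|]; last exact: negligible_set0.
case: ifPn => [/eqP p0|_]; last exact: negligible_set0.
apply/negligibleP => //; apply: open_measurable_rV; exact: ball_open.
Qed.

(** Rational balls of measure zero cover the complement of the support. *)
Lemma probability_msupport (P : probability Rd R) : P (msupport P) = 1%E.
Proof.
have mS := measurable_msupport P.
have P0 : P (~` msupport P) = 0%E.
  by apply: measure_negligible; [exact: measurableC|exact: negligible_msupportC].
rewrite -[X in P X]setCK probability_setC; last exact: measurableC.
by rewrite [X in (1 - X)%E]P0 sube0.
Qed.

Lemma msupport_nonempty (P : probability Rd R) : msupport P !=set0.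
Proof.
apply/set0P/negP => /eqP S0; have := probability_msupport P.
by rewrite S0 measure0 => /eqP; rewrite eq_sym onee_eq0.
Qed.

Lemma enorm_ge0 (x : Rd) : 0 <= enorm x.
Proof. exact: sqrtr_ge0. Qed.

Lemma enormZ (k : R) (x : Rd) : enorm (k *: x) = `|k| * enorm x.
Proof.
rewrite /enorm -sqrtr_sqr -sqrtrM ?sqr_ge0//; congr Num.sqrt.
by rewrite mulr_sumr; apply: eq_bigr => i _; rewrite mxE exprMn.
Qed.

Lemma enormN (x : Rd) : enorm (- x) = enorm x.
Proof. by rewrite -scaleN1r enormZ normrN1 mul1r. Qed.

Lemma enorm0 : enorm (0 : Rd) = 0.
Proof. by rewrite -(scale0r 0) enormZ normr0 mul0r. Qed.

Lemma enorm_le_norm (x : Rd) : enorm x <= d%:R * `|x|.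
Proof.
rewrite -[leRHS]ger0_norm ?mulr_ge0// -sqrtr_sqr ler_sqrt ?sqr_ge0//.
rewrite exprMn; apply: (@le_trans _ _ (\sum_(i < d) `|x| ^+ 2)).
  apply: ler_sum => i _; rewrite -real_normK ?num_real// ler_sqr ?nnegrE//.
  by rewrite [leRHS]/Num.norm /= mx_normrE; exact: (le_bigmax _ (fun k : 'I_1 *
    'I_d => `|x k.1 k.2|) (ord0, i)).
rewrite sumr_const card_ord -[leLHS]mulr_natl ler_wpM2r ?sqr_ge0//.
case: (d) => [|n]; first by rewrite expr2 mulr0.
by rewrite expr2 ler_peMl// ler1n.
Qed.

Lemma continuous_enorm : continuous (@enorm R d).
Proof.
have cs : continuous (fun x : Rd => \sum_(i < d) x ord0 i ^+ 2).
  apply: (@continuous_big R 'I_d +%R 0 predT _ Rd (index_enum 'I_d)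
    (fun i x => x ord0 i ^+ 2)) => [|i _ x].
    by move=> z; apply: cvgD; [exact: cvg_fst|exact: cvg_snd].
  have h := @coord_continuous R 1 d ord0 i x.
  exact: (@cvgM _ _ _ (nbhs_filter x) _ _ _ _ h h).
move=> x; apply: (@continuous_comp _ _ _ _ (@Num.sqrt R)); first exact: cs.
exact: sqrt_continuous.
Qed.

Lemma open_eball (x : Rd) (r : R) : open (eball x r).
Proof.
rewrite (_ : eball x r = (fun y => enorm (y - x)) @^-1` [set t | t < r])//.
apply: open_comp => [y _|]; last exact: open_lt.
apply: (@continuous_comp Rd Rd R (fun z : Rd => z - x) (@enorm R d) y).
  exact: (cvgB (@cvg_id _ _) (cvg_cst x)).
exact: continuous_enorm.
Qed.

Lemma measurable_eball (x : Rd) (r : R) : measurable (eball x r).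
Proof. by apply: open_measurable_rV; exact: open_eball. Qed.

Lemma enorm_ball (r : R) : 0 < r -> exists2 s : R, 0 < s &
  forall x y : Rd, ball x s y -> enorm (x - y) < r.
Proof.
move=> r0; exists (r / d.+1%:R) => [|x y]; first by rewrite divr_gt0.
rewrite -ball_normE /= => xy; apply: le_lt_trans (enorm_le_norm _) _.
apply: (@le_lt_trans _ _ (d.+1%:R * `|x - y|)).
  by rewrite ler_wpM2r// ler_nat.
by rewrite mulrC -ltr_pdivlMr.
Qed.

Lemma ediam_ub (A : set Rd) x y : compact A -> A x -> A y ->
  enorm (x - y) <= ediam A.
Proof.
move=> cA Ax Ay; apply: ub_le_sup; last by exists (x, y).
have [M [_ AM]] := compact_bounded cA.
exists (d%:R * ((M + 1) + (M + 1))) => _ [[a b] [/= Aa Ab] <-].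
apply: le_trans (enorm_le_norm _) _; rewrite ler_wpM2l//.
rewrite (le_trans (ler_normB _ _))// lerD//; apply: AM => //; rewrite ltrDl//.
Qed.

End support.

Section modulus.
Context (R : realType).

(** Continuity of a modulus at a point of the half-line, in epsilon-delta form. *)
Lemma modulus_cvg (omega : R -> R) (r : R) (e : R) : modulus omega -> 0 <= r ->
  0 < e -> exists2 s : R, 0 < s &
    forall t, 0 <= t -> `|r - t| < s -> `|omega r - omega t| < e.
Proof.
move=> [_ _ /subspace_continuousP co o0] r0 e0.
have := co r; rewrite /= in_itv /= r0 => /(_ isT).
move=> /cvgrPdist_lt/(_ _ e0).
rewrite near_withinE => /nbhs_ballP[s /= s0 H]; exists s => // t t0 ts.
by have := H t; rewrite /ball /= => /(_ ts); apply; rewrite in_itv /= t0.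
Qed.

Lemma modulus_small (omega : R -> R) (e : R) : modulus omega -> 0 < e ->
  exists2 s : R, 0 < s & forall t, 0 <= t -> t < s -> omega t < e.
Proof.
move=> om e0; have [s s0 sP] := modulus_cvg om (lexx 0) e0.
exists s => // t t0 ts; have := sP t t0; rewrite sub0r normrN ger0_norm//.
move=> /(_ ts); case: om => _ _ _ ->; rewrite sub0r normrN.
exact: le_lt_trans (ler_norm _).
Qed.

End modulus.

Section continuous_on_product.
Context (R : realType) (n m : nat).
Local Notation X := 'rV[R]_n.
Local Notation Y := 'rV[R]_m.

(** Measurability is for the product sigma-algebra: the superlevel sets are
relatively open, hence traces of countable unions of products of rational balls. *)
Lemma measurable_continuous_on (A : set (X * Y)) (c : X * Y -> R) :
  (forall z e, A z -> 0 < e -> exists2 s : R, 0 < s &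
     forall z', A z' -> ball z.1 s z'.1 -> ball z.2 s z'.2 ->
       `|c z - c z'| < e) ->
  measurable_fun A c.
Proof.
move=> cont mA; apply: (measurability _ (RGenOInfty.measurableE R)) => //.
move=> _ [_ [a ->] <-].
pose B k (p : 'rV[rat]_k * nat) : set 'rV[R]_k :=
  ball (map_mx ratr p.1 : 'rV[R]_k) p.2.+1%:R^-1.
pose good := [set p : ('rV[rat]_n * nat) * ('rV[rat]_m * nat) |
  forall z, A z -> B n p.1 z.1 -> B m p.2 z.2 -> a < c z].
rewrite (_ : _ `&` _ = A `&` \bigcup_(p in good) (B n p.1 `*` B m p.2)).
  apply: measurableI => //; rewrite bigcup_mkcond.
  apply: countable_bigcupT_measurable; first exact: countableP.
  move=> p; case: ifPn => // _.
  by apply: measurableX; apply: open_measurable_rV; exact: ball_open.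
apply/seteqP; split => z /= [Az].
  rewrite in_itv /= andbT => az; split => //.
  have ca0 : 0 < c z - a by rewrite subr_gt0.
  have [s s0 sP] := cont z _ Az ca0.
  have : ball z.1 s z.1 by exact: ballxx.
  rewrite {1}(open_rV_bigcup (_ : open (ball z.1 s))); last exact: ball_open.
  move=> [p /= pz zp].
  have : ball z.2 s z.2 by exact: ballxx.
  rewrite {1}(open_rV_bigcup (_ : open (ball z.2 s))); last exact: ball_open.
  move=> [q /= qz zq].
  exists (p, q) => // z' Az' Bp Bq; have := sP z' Az' (pz _ Bp) (qz _ Bq).
  by rewrite ltr_norml => /andP[_]; rewrite ltrD2l ltrN2.
by move=> [p gp [Bp Bq]]; split => //; rewrite in_itv /= andbT; exact: gp.
Qed.

End continuous_on_product.

(** * Lebesgue measure under homotheties *)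

Section pushforward_domination.
Context (R : realType) (d1 d2 : measure_display)
  (X : measurableType d1) (Y : measurableType d2).
Local Open Scope ereal_scope.

(** If the image of [mu] under [phi] is at most [k] times [nu] on measurable sets,
the same comparison holds between integrals of nonnegative functions. *)
Lemma ge0_integral_comp_le (mu : {measure set X -> \bar R})
    (nu : {measure set Y -> \bar R}) (phi : X -> Y) (k : R)
    (f : Y -> \bar R) :
  measurable_fun setT phi -> (0 <= k)%R ->
  (forall A, measurable A -> mu (phi @^-1` A) <= k%:E * nu A) ->
  measurable_fun setT f -> (forall y, 0 <= f y) ->
  \int[mu]_x f (phi x) <= k%:E * \int[nu]_y f y.
Proof.
move=> mphi k0 dom mf f0.
pose mphi_mixin := isMeasurableFun.Build _ _ _ _ _ mphi.
pose p : {mfun X >-> Y} := HB.pack phi mphi_mixin.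
have -> : \int[mu]_x f (phi x) = \int[pushforward mu p]_y f y.
  by rewrite ge0_integral_pushforward// preimage_setT.
rewrite -(@ge0_integral_mscale _ _ _ _ _ _ (NngNum k0))//.
exact: ge0_le_measure_integral.
Qed.

End pushforward_domination.

Section lebesgue_affine.
Context (R : realType).

Lemma lebesgue_measure_affine (s b : R) (A : set R) : 0 < s -> measurable A ->
  @lebesgue_measure R ((fun a => s * a + b) @^-1` A) =
  ((s^-1)%:E * lebesgue_measure A)%E.
Proof.
move=> s0 mA.
have mphi : measurable_fun setT (fun a : measurableTypeR R => s * a + b :
  measurableTypeR R).
  by apply: measurable_funD => //; exact: measurable_funM.
pose mphi_mixin := isMeasurableFun.Build _ _ _ _ _ mphi.
pose p : {mfun measurableTypeR R >-> measurableTypeR R} := HB.pack (fun a : R =>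
  s * a + b) mphi_mixin.
pose nu : {measure set (measurableTypeR R) -> \bar R} :=
  mscale (NngNum (ltW s0)) (pushforward (@lebesgue_measure R) p).
have H : forall X : set (measurableTypeR R), measurable X -> lebesgue_measure X =
  nu mphi X.
  apply: lebesgue_measure_unique => _ [[u v] _ <-] /=; rewrite /nu.
  rewrite /mscale /= /pushforward /=.
  rewrite (_ : _ @^-1` _ = `](u - b) / s, (v - b) / s]%classic); last first.
    apply/seteqP; split => x /=; rewrite !in_itv /= ltr_pdivrMr// ler_pdivlMr//;
    by rewrite ltrBlDr lerBrDr (mulrC x).
  rewrite !lebesgue_measure_itv /= !lte_fin ltr_pM2r ?invr_gt0// ltrD2r.
  case: ifPn => _; last by rewrite mule0.
  rewrite -!EFinD -EFinM; congr EFin.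
  by field; rewrite gt_eqF.
rewrite (H A mA) /nu /mscale /= /pushforward /= muleA -EFinM mulVf ?gt_eqF// mul1e.
by [].
Qed.

Lemma measurable_affine_rV n (s : R) (b : 'rV[R]_n) :
  measurable_fun setT (fun x : 'rV[R]_n => s *: x + b).
Proof.
apply: (measurability (@open 'rV[R]_n)) => // _ [A oA <-]; rewrite setTI.
apply: open_measurable_rV; apply: open_comp => // x _.
apply: (@cvgD _ _ _ _ (nbhs_filter x) _ _ _ _ _ (cvg_cst b)).
exact: (@scaler_continuous _ _ s x).
Qed.

(** By induction on the dimension: slice along the first coordinate, use the
induction hypothesis in each slice and the one-dimensional scaling across slices.
The equality is true, but only this inequality is needed. *)
Lemma lebesgue_rV_affine n (s : R) (b : 'rV[R]_n) (A : set 'rV[R]_n) :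
  0 < s -> measurable A ->
  (lebesgue_rV n ((fun x : 'rV[R]_n => (s *: x + b)%R) @^-1` A) <=
   (s ^- n)%:E * lebesgue_rV n A)%E.
Proof.
move=> s0; elim: n b A => [|n ih] b A mA.
  rewrite expr0 invr1 mul1e /= !diracE.
  rewrite (_ : _ \in _ = (0 \in A))//.
  by apply/idP/idP => /set_mem h; apply/mem_set; move: h => /=;
    rewrite (_ : s *: 0 + b = 0)//; apply/rowP => -[].
rewrite /= /lebesgue_step /pushforward /product_measure1.
pose b' : 'rV[R]_n := \row_i b ord0 (lift ord0 i).
pose S (a : R) : set 'rV[R]_n := xsection (@rV_cons R n @^-1` A) a.
have mA' : measurable (@rV_cons R n @^-1` A).
  by rewrite -[X in measurable X]setTI; exact: measurable_rV_cons.
have mS a : measurable (S a) by exact: measurable_xsection.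
have mf : measurable_fun setT (lebesgue_rV n \o S).
  exact: measurable_fun_xsection.
apply: (@le_trans _ _ (\int[lebesgue_measure]_a
   ((s ^- n)%:E * lebesgue_rV n (S (s * a + b ord0 ord0)%R)))%E).
  apply: ge0_le_integral => //.
  - have mA2 : measurable (@rV_cons R n @^-1` ((fun x => s *: x + b) @^-1` A)).
      rewrite -[X in measurable X]setTI; apply: measurable_rV_cons => //.
      by rewrite -[X in measurable X]setTI; exact: measurable_affine_rV.
    exact: (measurable_fun_xsection (lebesgue_rV n) mA2).
  - apply: measurable_funeM; apply: (measurableT_comp mf).
    by apply: measurable_funD => //; exact: measurable_funM.
  - move=> a _ /=; apply: le_trans (ih b' _ (mS _)).
    rewrite le_eqVlt; apply/orP; left; apply/eqP; congr (lebesgue_rV n _).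
    apply/seteqP; split => v /=; rewrite /S /xsection /= !inE /=;
      rewrite (_ : s *: rV_cons (a, v) + b = rV_cons (s * a + b ord0 ord0, s *: v
        + b'))//;
      apply/rowP => i; rewrite !mxE /=; case: unliftP => [j ->|->] /=;
      rewrite ?mxE//.
rewrite ge0_integralZl//; last 2 first.
- apply: (measurableT_comp mf).
  by apply: measurable_funD => //; exact: measurable_funM.
- by rewrite lee_fin invr_ge0 exprn_ge0// ltW.
rewrite exprS invfM mulrC EFinM -muleA lee_wpmul2l//.
  by rewrite lee_fin invr_ge0 exprn_ge0// ltW.
apply: (@ge0_integral_comp_le _ _ _ _ _ lebesgue_measure lebesgue_measure
  (fun a => s * a + b ord0 ord0) s^-1 (lebesgue_rV n \o S)) => //.
- by apply: measurable_funD => //; exact: measurable_funM.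
- by rewrite invr_ge0 ltW.
- move=> B mB; rewrite le_eqVlt; apply/orP; left; apply/eqP.
  exact: lebesgue_measure_affine.
Qed.

End lebesgue_affine.

(** * Averages along segments under a bounded density *)

Section density.
Context (R : realType) (d : nat).
Local Notation Rd := 'rV[R]_d.
Variables (P : probability Rd R) (rho : Rd -> R) (lambda Lambda : R).
Local Notation Om := (msupport P).
Hypotheses (P_convex : convex_set Om) (P_density : is_density P rho)
  (lambda_gt0 : 0 < lambda)
  (rho_bounds : forall x, Om x -> lambda <= rho x <= Lambda).

Lemma Lambda_ge : lambda <= Lambda.
Proof.
have [x /rho_bounds/andP[h1 h2]] := msupport_nonempty P.
exact: le_trans h1 h2.
Qed.

Lemma density_le A : measurable A -> A `<=` Om ->
  (P A <= Lambda%:E * lebesgue_rV d A)%E.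
Proof.
move=> mA AO; case: P_density => mrho rho0 ->//.
rewrite -integral_cst//; apply: ge0_le_integral => //.
- by move=> x _; rewrite lee_fin.
- exact/measurable_EFinP/measurable_funTS.
- by move=> x /AO /rho_bounds /andP[_]; rewrite lee_fin.
Qed.

Lemma density_ge A : measurable A -> A `<=` Om ->
  (lebesgue_rV d A <= (lambda^-1)%:E * P A)%E.
Proof.
move=> mA AO; rewrite lee_pdivlMl//; case: P_density => mrho rho0 ->//.
rewrite -integral_cst//; apply: ge0_le_integral => //.
- by move=> x _; rewrite lee_fin ltW.
- exact/measurable_EFinP/measurable_funTS.
- by move=> x /AO /rho_bounds /andP[+ _]; rewrite lee_fin.
Qed.

Lemma convex_supp (s : R) (x x' : Rd) : 0 <= s -> s <= 1 -> Om x -> Om x' ->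
  Om (s *: x + (1 - s) *: x').
Proof.
move=> s0 s1 Ox Ox'.
have := P_convex (Itv01 s0 s1) (mem_set Ox) (mem_set Ox').
by move=> /set_mem.
Qed.

(** Images of [P] under homotheties centered at a point of the support: convexity
keeps the image inside the support, where [P] and Lebesgue measure are comparable. *)
Lemma segment_domination (s : R) (x' : Rd) (A : set Rd) : 0 < s -> s <= 1 ->
  Om x' -> measurable A ->
  (P ((fun x : Rd => (s *: x + (1 - s) *: x')%R) @^-1` A) <=
   (s ^- d * (Lambda / lambda))%:E * P A)%E.
Proof.
move=> s0 s1 Ox' mA.
have mO := measurable_msupport P.
have P1 := probability_msupport P.
pose T (x : Rd) : Rd := s *: x + (1 - s) *: x'.
have mT (B : set Rd) : measurable B -> measurable (T @^-1` B).
  by move=> mB; rewrite -[X in measurable X]setTI; exact: measurable_affine_rV.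
rewrite -(probability_setI_full mO P1); last exact: mT.
rewrite -(probability_setI_full mO P1 mA).
have mAO : measurable (A `&` Om) by exact: measurableI.
apply: (@le_trans _ _ (Lambda%:E * lebesgue_rV d (T @^-1` (A `&` Om)))%E).
  apply: le_trans (@density_le _ _ _) _.
  - by apply: measurableI => //; exact: mT.
  - by move=> x [].
  rewrite lee_wpmul2l//; first by rewrite lee_fin (le_trans (ltW lambda_gt0) Lambda_ge).
  apply: le_measure; rewrite ?inE; [by apply: measurableI => //; exact: mT|exact: mT|].
  by move=> x [Ax Ox]; split => //; apply: convex_supp => //; exact: ltW.
have Ls : (lebesgue_rV d (T @^-1` (A `&` Om)) <=
    (s ^- d)%:E * lebesgue_rV d (A `&` Om))%E.
  exact: lebesgue_rV_affine.
apply: le_trans (lee_wpmul2l _ Ls) _.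
  by rewrite lee_fin (le_trans (ltW lambda_gt0) Lambda_ge).
apply: le_trans (lee_wpmul2l _ (lee_wpmul2l _ (density_ge mAO _))) _ => //.
- by rewrite lee_fin (le_trans (ltW lambda_gt0) Lambda_ge).
- by rewrite lee_fin invr_ge0 exprn_ge0// ltW.
by rewrite !muleA -!EFinM mulrCA mulrA.
Qed.

Lemma bmeas_segment (s : R) (x' : Rd) (F : Rd -> R) : 0 <= s -> s <= 1 ->
  Om x' -> bmeas Om F -> bmeas Om (fun x => F (s *: x + (1 - s) *: x')).
Proof.
move=> s0 s1 Ox' [mF [M FM]]; have mO := measurable_msupport P.
split; last by exists M => x Ox; apply: FM; exact: convex_supp.
apply: (@eq_measurable_fun _ _ _ _ _ (fun x : Rd => (F \_ Om) (s *: x + (1 - s)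
  *: x'))).
  by move=> x /set_mem Ox; rewrite patchE mem_set//; exact: convex_supp.
apply: measurable_funTS; apply: (@measurableT_comp _ _ _ _ _ _ (F \_ Om)).
  exact/(measurable_restrictT _ mO).
exact: measurable_affine_rV.
Qed.

Lemma segment_average (s : R) (x' : Rd) (F : Rd -> R) : 0 < s -> s <= 1 ->
  Om x' -> bmeas Om F -> (forall x, Om x -> 0 <= F x) ->
  \int[P]_(x in Om) F (s *: x + (1 - s) *: x') <=
  s ^- d * (Lambda / lambda) * \int[P]_(x in Om) F x.
Proof.
move=> s0 s1 Ox' bF F0.
have mO := measurable_msupport P.
pose G := F \_ Om.
have mG : measurable_fun setT G by apply/(measurable_restrictT _ mO); case: bF.
have G0 x : 0 <= G x.
  by rewrite /G patchE; case: ifPn => // /set_mem; exact: F0.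
have mT : measurable_fun setT (fun x : Rd => s *: x + (1 - s) *: x').
  exact: measurable_affine_rV.
have bFT := bmeas_segment (ltW s0) s1 Ox' bF.
rewrite -lee_fin EFinM !EFin_int//.
apply: (@le_trans _ _ (\int[P]_x (G (s *: x + (1 - s) *: x'))%:E)%E).
  rewrite [leLHS]integral_mkcond; apply: ge0_le_integral => //.
  - move=> x _. rewrite patchE; case: ifPn => // /set_mem Ox; rewrite lee_fin.
    by apply: F0; apply: convex_supp => //; exact: ltW.
  - by apply/(measurable_restrictT _ mO)/measurable_EFinP; case: bFT.
  - by apply/measurable_EFinP; exact: (measurableT_comp mG).
  - move=> x _; rewrite /= patchE; case: ifPn => [/set_mem Ox|_]; last by rewrite
    lee_fin.
    rewrite /G lee_fin patchE mem_set//.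
    by apply: convex_supp => //; exact: ltW.
apply: le_trans (@ge0_integral_comp_le _ _ _ _ _ P P _
  (s ^- d * (Lambda / lambda)) (EFin \o G) mT _ _ _ _) _.
- rewrite mulr_ge0 ?invr_ge0 ?exprn_ge0 ?(ltW s0)// divr_ge0 ?(ltW lambda_gt0)//.
  exact: le_trans (ltW lambda_gt0) Lambda_ge.
- by move=> A mA; exact: segment_domination.
- exact/measurable_EFinP.
- by move=> x; rewrite lee_fin.
rewrite [in leRHS]integral_mkcond; under [in leRHS]eq_integral do rewrite restrict_EFin.
by [].
Qed.

(** A single point is Lebesgue-null in positive dimension, so the support of a
measure with a density is not reduced to a point. *)
Lemma ediam_gt0 : (0 < d)%N -> compact Om -> 0 < ediam Om.
Proof.
move=> d0 cO; have [x Ox] := msupport_nonempty P.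
rewrite lt_neqAle (le_trans (enorm_ge0 _) (ediam_ub cO Ox Ox)) andbT.
apply/negP => /eqP d00.
have Ox1 : Om `<=` [set x].
  move=> y Oy /=; have := ediam_ub cO Oy Ox; rewrite -d00 => h.
  have /eqP : enorm (y - x) = 0 by apply/eqP; rewrite eq_le h enorm_ge0.
  rewrite sqrtr_eq0 => hs.
  have {}hs : \sum_(i < d) (y - x) ord0 i ^+ 2 = 0.
    by apply/eqP; rewrite eq_le hs sumr_ge0// => i _; exact: sqr_ge0.
  apply/eqP; rewrite -subr_eq0; apply/eqP/rowP => i; rewrite [RHS]mxE.
  move/eqP: hs; rewrite psumr_eq0; last by move=> j _; exact: sqr_ge0.
  by move=> /allP/(_ i (mem_index_enum _)); rewrite sqrf_eq0 => /eqP.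
have L0 : lebesgue_rV d [set y : Rd | forall i, [set x ord0 i] (y ord0 i)] = 0%E.
  rewrite (lebesgue_rV_box (A := fun i => [set x ord0 i]))//.
  case: (d) d0 x {Ox Ox1} => // n _ x.
  by rewrite big_ord_recl lebesgue_measure_set1 mul0e.
have : (P Om <= Lambda%:E * lebesgue_rV d Om)%E.
  by apply: density_le => //; exact: measurable_msupport.
rewrite [X in lebesgue_rV d X](_ : Om =
  [set y : Rd | forall i, [set x ord0 i] (y ord0 i)]); last first.
  apply/seteqP; split => [y /Ox1 -> //|y h].
  by rewrite (_ : y = x)//; apply/rowP => i; exact: h.
by rewrite L0 mule0 [X in (X <= _)%E -> _](probability_msupport P) lee_fin ler10.
Qed.

End density.

(** * A Poincare inequality for direct sums *)

(** The Cauchy-Schwarz inequality against the constant family 1. *)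
Lemma sqr_sum_le (R : realFieldType) n (a : nat -> R) :
  (\sum_(i < n) a i) ^+ 2 <= n%:R * \sum_(i < n) a i ^+ 2.
Proof.
elim: n => [|n ih]; first by rewrite !big_ord0 expr0n mul0r.
rewrite !big_ord_recr /=.
have H : 2 * (\sum_(i < n) a i) * a n <= \sum_(i < n) a i ^+ 2 + n%:R * a n ^+ 2.
  rewrite mulr_sumr mulr_suml mulr_natl -[X in _ + _ *+ X]card_ord -sumr_const.
  rewrite -big_split /=; apply: ler_sum => i _.
  by have := sqr_ge0 (a i - a n); lra.
move: ih H; set S := \sum_(i < n) a i; set T := \sum_(i < n) a i ^+ 2.
by rewrite -natr1 => ih H; nra.
Qed.

Section poincare_arithmetic.
Context (R : realFieldType).
Implicit Types a b k n p q u v e x : R.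

Lemma chain_total n a b : n * a + ((n - 1) * a + b) = (2 * n - 1) * a + b.
Proof. ring. Qed.

Lemma mean_bound q u n k e : 1 <= n -> e <= k * e ->
  q * (2 * u) <= 2 * n * ((2 * n - 1) * (k * e) + e) ->
  q * u <= 2 * n ^+ 2 * k * e.
Proof.
move=> n1 ke; set x := k * e in ke *.
have : 2 * n * ((2 * n - 1) * x + e) <= 2 * n * ((2 * n - 1) * x + x).
  by rewrite ler_wpM2l// ?lerD2l// mulr_ge0// (le_trans _ n1).
have -> : 2 * n ^+ 2 * k * e = 2 * n ^+ 2 * x by rewrite /x; ring.
nra.
Qed.

(** Here [u] and [v] stand for squared norms, and [e], [x] for the energy on the
set where the slack is large and a multiple of it. *)
Lemma combine_bounds p q u v e x : 0 < p -> p <= 1 -> 0 < q -> q <= 1 ->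
  0 <= u -> 0 <= e -> e <= x ->
  q * u <= 2 * x -> p * v <= 2 * e + 2 * u -> (u + v) * (p * q) <= 8 * x.
Proof.
move=> p0 p1 q0 q1 u0 e0 ex ub vb.
have h1 : p * (q * u) <= q * u by rewrite ler_piMl// mulr_ge0// ltW.
have h2 : q * (p * v) <= q * (2 * e) + 2 * (q * u).
  by have := ler_wpM2l (ltW q0) vb; lra.
have h3 : q * e <= e by rewrite ler_piMl.
have -> : (u + v) * (p * q) = p * (q * u) + q * (p * v) by ring.
lra.
Qed.

End poincare_arithmetic.

Section poincare.
Context (R : realType) (d : nat).
Local Notation Rd := 'rV[R]_d.
Variables (P Q : probability Rd R) (rho : Rd -> R) (lambda Lambda : R).
Local Notation Om := (msupport P).
Local Notation Om' := (msupport Q).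
Hypotheses (P_convex : convex_set Om) (P_density : is_density P rho)
  (lambda_gt0 : 0 < lambda)
  (rho_bounds : forall x, Om x -> lambda <= rho x <= Lambda).
Variables (u v : Rd -> R) (w : Rd * Rd -> R) (r p q : R) (N : nat).
Hypotheses (bu : bmeas Om u) (bv : bmeas Om' v) (bw : bmeas (Om `*` Om') w)
  (w_ge0 : forall z, 0 <= w z) (r_ge0 : 0 <= r) (N_gt0 : (0 < N)%N)
  (N_diam : forall x x', Om x -> Om x' -> enorm (x - x') <= N%:R * r)
  (p_gt0 : 0 < p) (p_le1 : p <= 1) (q_gt0 : 0 < q) (q_le1 : q <= 1)
  (P_ball : forall x, Om x -> p <= fine (P (eball x r)))
  (Q_ball : forall y, Om' y -> q <= fine (Q (eball y r)))
  (w_row : forall x, Om x -> exists2 y0, Om' y0 & forall x' y,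
     Om x' -> Om' y -> enorm (x' - x) <= r -> eball y0 r y -> w (x', y) = 1)
  (w_col : forall y, Om' y -> exists2 x0, Om x0 & forall x,
     Om x -> eball x0 r x -> w (x, y) = 1).

Let mO : measurable Om := measurable_msupport P.
Let mO' : measurable Om' := measurable_msupport Q.
Let P1 : P Om = 1%E := probability_msupport P.
Let Q1 : Q Om' = 1%E := probability_msupport Q.

Let k := N%:R ^+ d * (Lambda / lambda).
(** The energy of the slice at [x]; [w] plays the role of the indicator of the set
where the slack is large. *)
Let F x := \int[Q]_(y in Om') (w (x, y) * (u x + v y) ^+ 2).
Let EF := \int[P]_(x in Om) F x.

Let bD : bmeas (Om `*` Om') (fun z => w z * (u z.1 + v z.2) ^+ 2).
Proof. by bmeas_auto. Qed.

Let bF : bmeas Om F.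
Proof. exact: (bmeas_int1 P Q mO mO' bD). Qed.

Let F_ge0 x : 0 <= F x.
Proof. by apply: Rintegral_ge0 => y _; rewrite mulr_ge0 ?sqr_ge0. Qed.

Let EF_ge0 : 0 <= EF.
Proof. by apply: Rintegral_ge0 => y _; exact: F_ge0. Qed.

Let k_ge1 : 1 <= k.
Proof.
rewrite -[1]mulr1 ler_pM// ?exprn_ege1 ?ler1n//.
rewrite ler_pdivlMr// mul1r; exact: (Lambda_ge rho_bounds).
Qed.

(** Nearby points share a ball of [y] on which [w] is 1 at both; there
[u x - u x'] is the difference of two values of the direct sum. *)
Let step x x' : Om x -> Om x' -> enorm (x' - x) <= r ->
  q * (u x - u x') ^+ 2 <= 2 * (F x + F x').
Proof.
move=> Ox Ox' xx'; have [y0 Oy0 wy] := w_row Ox.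
have b1 := bmeas_sec1 mO mO' bD Ox.
have b2 := bmeas_sec1 mO mO' bD Ox'.
rewrite /F -intD// -intZ//; last exact: bmeasD.
have bi : bmeas Om' (\1_(eball y0 r) : Rd -> R).
  by apply: bmeas_indic; exact: measurable_eball.
apply: (@le_trans _ _ (\int[Q]_(y in Om') ((u x - u x') ^+ 2 * \1_(eball y0 r) y))).
  rewrite intZ// mulrC ler_wpM2l ?sqr_ge0// int_indic//; last exact: measurable_eball.
  rewrite (probability_setI_full mO' Q1); last exact: measurable_eball.
  exact: Q_ball.
apply: int_le => //; [by bmeas_auto|by apply: bmeasM; [bmeas_auto|exact: bmeasD]|].
move=> y Oy /=; rewrite indicE; case: (boolP (y \in _)) => [/set_mem yB|_].
  rewrite !wy ?subrr ?enorm0//.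
  rewrite !mul1r mulr1.
  by have := sqr_ge0 ((u x + v y) + (u x' + v y)); lra.
by rewrite mulr0 mulr_ge0// addr_ge0// mulr_ge0 ?sqr_ge0.
Qed.

(** The points dividing the segment from [x] to [x'] into [N] equal steps. *)
Let z (x x' : Rd) (i : nat) : Rd :=
  (1 - i%:R / N%:R) *: x + (1 - (1 - i%:R / N%:R)) *: x'.

Let N0 : 0 < N%:R :> R. Proof. by rewrite ltr0n. Qed.

Let s_ge0 i : (i <= N)%N -> 0 <= 1 - i%:R / N%:R :> R.
Proof. by move=> iN; rewrite subr_ge0 ler_pdivrMr// mul1r ler_nat. Qed.

Let s_le1 i : 1 - i%:R / N%:R <= 1 :> R.
Proof. by rewrite gerBl divr_ge0. Qed.

Let z_in x x' i : Om x -> Om x' -> (i <= N)%N -> Om (z x x' i).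
Proof. by move=> Ox Ox' iN; apply: convex_supp => //; exact: s_ge0. Qed.

Let z0 x x' : z x x' 0 = x.
Proof. by rewrite /z mul0r subr0 subrr scale1r scale0r addr0. Qed.

Let zN x x' : z x x' N = x'.
Proof. by rewrite /z divff ?gt_eqF// subrr subr0 scale1r scale0r add0r. Qed.

Let z_step x x' i : Om x -> Om x' -> enorm (z x x' i.+1 - z x x' i) <= r.
Proof.
move=> Ox Ox'.
have -> : z x x' i.+1 - z x x' i = N%:R^-1 *: (x' - x).
  rewrite /z -natr1; apply/rowP => j; rewrite !mxE.
  by field; rewrite gt_eqF.
rewrite enormZ ger0_norm ?invr_ge0// mulrC ler_pdivrMr// mulrC.
exact: N_diam.
Qed.

Let chain x x' : Om x -> Om x' ->
  q * (u x - u x') ^+ 2 <=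
  N%:R * (\sum_(i < N) (2 * (F (z x x' i) + F (z x x' i.+1)))).
Proof.
move=> Ox Ox'.
have -> : u x - u x' = \sum_(i < N) (u (z x x' i) - u (z x x' i.+1)).
  rewrite -(big_mkord xpredT (fun i => u (z x x' i) - u (z x x' i.+1))).
  under eq_bigr do rewrite -opprB.
  by rewrite sumrN telescope_sumr// opprB z0 zN.
apply: (@le_trans _ _ (q * (N%:R * \sum_(i < N) (u (z x x' i) - u (z x x' i.+1))
  ^+ 2))).
  rewrite ler_wpM2l ?(ltW q_gt0)//.
  exact: (sqr_sum_le N (fun i => u (z x x' i) - u (z x x' i.+1))).
rewrite mulrCA ler_wpM2l// mulr_sumr ler_sum// => i _.
apply: step; [by apply: z_in => //; exact: ltnW|exact: z_in|exact: z_step].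
Qed.

Let bFz x' i : Om x' -> (i <= N)%N -> bmeas Om (fun x => F (z x x' i)).
Proof.
move=> Ox' iN; apply: bmeas_segment => //; exact: s_ge0.
Qed.

(** The weight of [x] in the intermediate point is at least [1 / N], which bounds
the factor coming from the change of variables by [N ^+ d]. *)
Let int_Fz x' i : Om x' -> (i < N)%N ->
  \int[P]_(x in Om) F (z x x' i) <= k * EF.
Proof.
move=> Ox' iN; pose s : R := 1 - i%:R / N%:R.
have sN : N%:R^-1 <= s.
  by rewrite /s lerBrDr -[X in X + _]mul1r -mulrDl ler_pdivrMr// mul1r nat1r ler_nat.
have s0 : 0 < s by rewrite (lt_le_trans _ sN)// invr_gt0.
apply: le_trans (@segment_average _ _ _ _ _ _ P_convex P_density lambda_gt0
  rho_bounds s x' F s0 (s_le1 _) Ox' bF (fun x _ => F_ge0 x)) _.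
rewrite ler_wpM2r// /k ler_wpM2r//.
  by rewrite divr_ge0 ?(ltW lambda_gt0)// (le_trans (ltW lambda_gt0) (Lambda_ge
    rho_bounds)).
rewrite -exprVn lerXn2r ?nnegrE ?invr_ge0 ?(ltW s0) ?(ltW N0)//.
by rewrite -[leRHS]invrK lef_pV2// posrE invr_gt0.
Qed.

(** The endpoint [z x x' N = x'] is not averaged, whence the separate term [F x']. *)
Let int_diff x' : Om x' ->
  q * \int[P]_(x in Om) (u x - u x') ^+ 2 <=
  2 * N%:R * ((2 * N%:R - 1) * (k * EF) + F x').
Proof.
move=> Ox'; rewrite -intZ//; last by bmeas_auto.
have bs (i : 'I_N) : bmeas Om (fun x => 2 * (F (z x x' i) + F (z x x' i.+1))).
  apply: bmeasM; first exact: bmeas_cst.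
  by apply: bmeasD; apply: bFz => //; exact: ltnW.
apply: (@le_trans _ _ (\int[P]_(x in Om)
  (N%:R * (\sum_(i < N) (2 * (F (z x x' i) + F (z x x' i.+1))))))).
  apply: int_le => //; first by bmeas_auto.
    by apply: bmeasM; [exact: bmeas_cst|exact: bmeas_sum].
  by move=> x Ox; exact: chain.
rewrite intZ//; last exact: bmeas_sum.
rewrite -[leRHS]mulrA [2 * (N%:R * _)]mulrCA ler_wpM2l//.
rewrite int_sum//.
have iE (i : 'I_N) : \int[P]_(x in Om) (2 * (F (z x x' i) + F (z x x' i.+1))) =
    2 * (\int[P]_(x in Om) F (z x x' i) + \int[P]_(x in Om) F (z x x' i.+1)).
  have b1 : bmeas Om (fun x => F (z x x' i)) by apply: bFz => //; exact: ltnW.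
  have b2 : bmeas Om (fun x => F (z x x' i.+1)) by exact: bFz.
  by rewrite (intZ P mO 2 (bmeasD b1 b2)) (intD P mO b1 b2).
under eq_bigr do rewrite iE.
rewrite -mulr_sumr ler_wpM2l// big_split /=.
have h1 : \sum_(i < N) \int[P]_(x in Om) F (z x x' i) <= N%:R * (k * EF).
  rewrite mulr_natl -[X in _ *+ X]card_ord -sumr_const; apply: ler_sum => i _.
  exact: int_Fz.
have h2 : \sum_(i < N) \int[P]_(x in Om) F (z x x' i.+1) <=
    (N%:R - 1) * (k * EF) + F x'.
  case EN : N => [|n]; first by move: N_gt0; rewrite EN.
  rewrite -EN; rewrite [in leLHS]EN big_ord_recr /= -EN; apply: lerD.
    rewrite EN -natr1 addrK mulr_natl -[X in _ *+ X]card_ord -sumr_const.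
    by apply: ler_sum => i _; apply: int_Fz => //; rewrite EN ltnS.
  rewrite (@eq_int _ _ _ P Om _ (fun=> F x')); first by rewrite int_cst.
  by move=> x Ox; rewrite zN.
by apply: le_trans (lerD h1 h2) _; rewrite chain_total.
Qed.

Hypothesis u_mean : \int[P]_(x in Om) u x = 0.

Let U := \int[P]_(x in Om) (u x ^+ 2).
Let V := \int[Q]_(y in Om') (v y ^+ 2).

Let int_sqr_diff x' : \int[P]_(x in Om) (u x - u x') ^+ 2 = U + u x' ^+ 2.
Proof.
rewrite (@eq_int _ _ _ P Om _ (fun x => u x ^+ 2 + ((- 2 * u x') * u x + u x' ^+
  2))); last first.
  by move=> x _; ring.
rewrite intD ?intD ?intZ//; try by bmeas_auto.
by rewrite u_mean mulr0 add0r int_cst.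
Qed.

(** Integrated in both variables, the squared difference of [u] at two points gives
twice the variance of [u]. *)
Let u_bound : q * U <= 2 * N%:R ^+ 2 * k * EF.
Proof.
have H : q * (2 * U) <= 2 * N%:R * ((2 * N%:R - 1) * (k * EF) + EF).
  have -> : q * (2 * U) = \int[P]_(x in Om) (q * (U + u x ^+ 2)).
    rewrite intZ ?intD ?int_cst//; try by bmeas_auto.
    by rewrite -/U -mulr2n mulr_natl.
  have -> : 2 * N%:R * ((2 * N%:R - 1) * (k * EF) + EF) =
    \int[P]_(x in Om) (2 * N%:R * ((2 * N%:R - 1) * (k * EF) + F x)).
    by rewrite intZ ?intD ?int_cst//; bmeas_auto.
  apply: int_le => //; try by bmeas_auto.
  by move=> x Ox; rewrite -int_sqr_diff; exact: int_diff.
by apply: mean_bound H; rewrite ?ler1n// ler_peMl.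
Qed.

(** Averaging [v y = (u x + v y) - u x] over a ball of [x] contained in the column
of [y]. *)
Let v_bound : p * V <= 2 * EF + 2 * U.
Proof.
pose G y := \int[P]_(x in Om) (w (x, y) * (u x + v y) ^+ 2).
have bG : bmeas Om' G by exact: (bmeas_int2 P Q mO mO' bD).
have -> : EF = \int[Q]_(y in Om') G y.
  by rewrite -(int_fubini2 P Q mO mO' bD) (int_fubini1 P Q mO mO' bD).
rewrite /V -!intZ//; try by bmeas_auto.
rewrite -[X in _ + X](@int_cst _ _ _ Q _ mO' Q1) -intD//; try by bmeas_auto.
apply: int_le => //; try by bmeas_auto.
move=> y Oy; have [x0 Ox0 wx] := w_col Oy.
have bi : bmeas Om (\1_(eball x0 r) : Rd -> R).
  by apply: bmeas_indic; exact: measurable_eball.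
have b1 := bmeas_sec2 mO mO' bD Oy.
rewrite /G /U -!intZ//; try by bmeas_auto.
rewrite -intD//; try by bmeas_auto.
apply: (@le_trans _ _ (\int[P]_(x in Om) (v y ^+ 2 * \1_(eball x0 r) x))).
  rewrite intZ// mulrC ler_wpM2l ?sqr_ge0// int_indic//; last exact: measurable_eball.
  rewrite (probability_setI_full mO P1); last exact: measurable_eball.
  exact: P_ball.
apply: int_le => //; try by bmeas_auto.
move=> x Ox /=; rewrite indicE; case: (boolP (x \in _)) => [/set_mem xB|_].
  rewrite wx// mul1r mulr1.
  by have := sqr_ge0 ((u x + v y) + u x); lra.
by rewrite mulr0 addr_ge0// mulr_ge0// ?sqr_ge0// mulr_ge0 ?sqr_ge0.
Qed.

(** The cross term vanishes when one of the summands has mean zero. *)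
Lemma sqr_osum_mean0 :
  \int[(P \x Q)%E]_(z in Om `*` Om') (u z.1 + v z.2) ^+ 2 = U + V.
Proof.
have bs : bmeas (Om `*` Om') (fun z => (u z.1 + v z.2) ^+ 2) by bmeas_auto.
rewrite (int_fubini1 P Q mO mO' bs) /=.
rewrite (@eq_int _ _ _ P Om _ (fun x => u x ^+ 2 + ((2 * \int[Q]_(y in Om') v y)
  * u x + V))); last first.
  move=> x _.
  rewrite [LHS](@eq_int _ _ _ Q Om' _ (fun y => u x ^+ 2 + ((2 * u x) * v y + v y
    ^+ 2))); last first.
    by move=> y _ /=; ring.
  rewrite intD ?intD ?intZ ?int_cst//; try by bmeas_auto.
  by rewrite [2 * _ * u x]mulrAC.
rewrite intD ?intD ?intZ ?int_cst//; try by bmeas_auto.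
by rewrite u_mean mulr0 add0r.
Qed.

(** The energy of a direct sum with mean-zero first component is controlled by its
energy on a set whose rows and columns contain balls of radius [r]. *)
Lemma poincare_osum :
  \int[(P \x Q)%E]_(z in Om `*` Om') (u z.1 + v z.2) ^+ 2 <=
  8 * (p * q)^-1 * (N%:R ^+ 2 * k) *
  \int[(P \x Q)%E]_(z in Om `*` Om') (w z * (u z.1 + v z.2) ^+ 2).
Proof.
rewrite sqr_osum_mean0 (int_fubini1 P Q mO mO' bD) -/EF.
rewrite mulrAC -mulrA mulrAC ler_pdivlMr ?mulr_gt0//.
have N1 : 1 <= N%:R ^+ 2 :> R by rewrite exprn_ege1// ler1n.
have ub := u_bound; have vb := v_bound.
have U0 : 0 <= U by apply: Rintegral_ge0 => x _; exact: sqr_ge0.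
set X := N%:R ^+ 2 * k * EF.
have EX : EF <= X by rewrite /X ler_peMl// mulr_ege1.
have ub2 : q * U <= 2 * X by rewrite /X mulrA (mulrA 2).
rewrite [EF * _]mulrC.
exact: combine_bounds ub2 vb.
Qed.

End poincare.

(** * The dual objective and its first-order conditions *)

Section pointwise.
Context (R : realFieldType).
Implicit Types t s h k M eps : R.
Local Notation pos x := (Num.max x 0).

(** Upper and lower quadratic models of the squared positive part, used
respectively for the perturbation of a maximizer and for concavity of [Gamma]. *)
Lemma pos_sqr_le t s : pos (t + s) ^+ 2 <= pos t ^+ 2 + 2 * pos t * s + s ^+ 2.
Proof.
case: (lerP t 0) => t0; case: (lerP (t + s) 0) => ts0; nra.
Qed.

Lemma pos_sqr_ge t s : pos t ^+ 2 + 2 * pos t * s <= pos (t + s) ^+ 2.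
Proof.
case: (lerP t 0) => t0; case: (lerP (t + s) 0) => ts0; nra.
Qed.

(** Strong monotonicity of the positive part at a point [k] bounded away from 0.
If [h] is negative, [(k - h) <= M] turns the linear gain [k] into a quadratic one. *)
Lemma pos_monotone_ge eps M h k : 0 < eps -> eps <= M -> `|h - k| <= M ->
  eps / 2 <= k ->
  (2 * M)^-1 * (h - k) ^+ 2 <= eps^-1 * (pos h - pos k) * (h - k).
Proof.
move=> e0 eM hk ke.
have M0 : 0 < M by exact: lt_le_trans eM.
have Me : 0 < 2 * M * eps by rewrite !mulr_gt0.
rewrite -(ler_pM2l Me).
have -> : 2 * M * eps * ((2 * M)^-1 * (h - k) ^+ 2) = eps * (h - k) ^+ 2.
  by field; rewrite gt_eqF.
have -> : 2 * M * eps * (eps^-1 * (pos h - pos k) * (h - k)) =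
  2 * M * ((pos h - pos k) * (h - k)) by field; rewrite gt_eqF.
have k0 : 0 < k by rewrite (lt_le_trans _ ke)// divr_gt0.
have -> : pos k = k by case: (lerP k 0) => //; rewrite leNgt k0.
move: hk; rewrite ler_norml => /andP[hk1 hk2].
case: (lerP h 0) => h0; last first.
  have : 0 <= (2 * M - eps) * (h - k) ^+ 2 by rewrite mulr_ge0 ?sqr_ge0//; lra.
  lra.
rewrite sub0r.
have h1 : eps / 2 * (2 * M) <= k * (2 * M) by rewrite ler_pM2r// mulr_gt0.
have h2 : eps * (k - h) <= k * (2 * M).
  have : eps * (k - h) <= eps * M by rewrite ler_pM2l//; lra.
  lra.
have h3 : 0 <= k - h by lra.
have := ler_wpM2r h3 h2; lra.
Qed.

Lemma pos_monotone h k : 0 <= (pos h - pos k) * (h - k).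
Proof.
case: (lerP h 0) => h0; case: (lerP k 0) => k0.
- by rewrite subrr mul0r.
- by rewrite mulr_le0//; lra.
- by rewrite mulr_ge0//; lra.
- by rewrite -expr2 sqr_ge0.
Qed.

Lemma linear_le_quadratic (l b : R) : 0 <= b ->
  (forall t, t * l <= t ^+ 2 * b) -> l = 0.
Proof.
move=> b0 H; have b1 : 0 < b + 1 by rewrite ltr_wpDl.
(* With this step the inequality becomes [t ^+ 2 * (b + 1) <= t ^+ 2 * b]. *)
set t := l / (b + 1); have lt : l = t * (b + 1) by rewrite divfK ?gt_eqF.
have := H t; rewrite [in X in X <= _]lt => h.
have : t ^+ 2 <= 0 by lra.
rewrite le_eqVlt ltNge sqr_ge0 orbF sqrf_eq0 => /eqP t0.
by rewrite lt t0 mul0r.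
Qed.

End pointwise.

Section L2norm_bounded.
Context (R : realType) (disp : measure_display) (T : measurableType disp).
Variables (mu : probability T R) (A : set T) (mA : measurable A).

Lemma L2norm_bmeas (f : T -> R) : bmeas A f ->
  L2norm mu A f = (Num.sqrt (\int[mu]_(x in A) f x ^+ 2))%:E.
Proof.
move=> bf; rewrite /L2norm unlock.
have -> : (\int[mu]_x (`|((EFin \o f) \_ A) x| `^ 2) =
           (\int[mu]_(x in A) f x ^+ 2)%:E)%E.
  rewrite EFin_int//; last by bmeas_auto.
  rewrite [RHS]integral_mkcond; apply: eq_integral => x _.
  rewrite !patchE; case: ifPn => _ /=.
    by rewrite powR_mulrn// real_normK// num_real.
  by rewrite normr0 powR0.
by rewrite poweR_EFin -powR12_sqrt// Rintegral_ge0// => x _; exact: sqr_ge0.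
Qed.

Lemma L2fun_bmeas (f : T -> R) : bmeas A f -> L2fun mu A f.
Proof. by move=> bf; split; [case: bf|rewrite L2norm_bmeas// ltry]. Qed.

End L2norm_bounded.

Section dual.
Context (R : realType) (d : nat).
Local Notation Rd := 'rV[R]_d.
Variables (P Q : probability Rd R) (c : Rd -> Rd -> R) (eps : R).
Hypothesis eps_gt0 : 0 < eps.
Local Notation Om := (msupport P).
Local Notation Om' := (msupport Q).
Local Notation S := (Om `*` Om').
Local Notation PQ := (P \x Q)%E.
Hypothesis bc : bmeas S (fun z => c z.1 z.2).

Let mO : measurable Om := measurable_msupport P.
Let mO' : measurable Om' := measurable_msupport Q.
Let P1 : P Om = 1%E := probability_msupport P.
Let Q1 : Q Om' = 1%E := probability_msupport Q.
Let mS : measurable S. Proof. exact: measurableX. Qed.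

(** The argument of the positive part in [Gamma]. *)
Definition slack (f g : Rd -> R) (z : Rd * Rd) : R := f z.1 + g z.2 - c z.1 z.2.

(** The density whose partial integrals are the two components of the gradient
of [Gamma]. *)
Definition residual (f g : Rd -> R) (z : Rd * Rd) : R :=
  1 - eps^-1 * Num.max (slack f g z) 0.

Lemma bmeas_slack f g : bmeas Om f -> bmeas Om' g -> bmeas S (slack f g).
Proof. by move=> bf bg; rewrite /slack; bmeas_auto. Qed.

Lemma bmeas_residual f g : bmeas Om f -> bmeas Om' g -> bmeas S (residual f g).
Proof.
move=> bf bg; have bs := bmeas_slack bf bg.
by apply: bmeasB; [exact: bmeas_cst|apply: bmeasM; [exact: bmeas_cst|exact:
  bmeas_max0]].
Qed.

Lemma prod_supp_full : PQ S = 1%E.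
Proof. by rewrite product_measure1E// [X in (X * _)%E]P1 [X in (_ * X)%E]Q1 mule1. Qed.

Lemma D1GammaE f g x : bmeas Om f -> bmeas Om' g -> Om x ->
  D1Gamma Q c eps f g x = \int[Q]_(y in Om') residual f g (x, y).
Proof.
move=> bf bg Ox.
have b1 := bmeas_sec1 mO mO' (bmeas_max0 (bmeas_slack bf bg)) Ox.
have b2 : bmeas Om' (fun y => eps^-1 * Num.max (slack f g (x, y)) 0).
  by apply: bmeasM => //; exact: bmeas_cst.
rewrite /residual (intB Q mO' (bmeas_cst _ 1) b2) (intZ Q mO' _ b1).
by rewrite (int_cst mO' Q1).
Qed.

Lemma D2GammaE f g y : bmeas Om f -> bmeas Om' g -> Om' y ->
  D2Gamma P c eps f g y = \int[P]_(x in Om) residual f g (x, y).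
Proof.
move=> bf bg Oy.
have b1 := bmeas_sec2 mO mO' (bmeas_max0 (bmeas_slack bf bg)) Oy.
have b2 : bmeas Om (fun x => eps^-1 * Num.max (slack f g (x, y)) 0).
  by apply: bmeasM => //; exact: bmeas_cst.
rewrite /residual (intB P mO (bmeas_cst _ 1) b2) (intZ P mO _ b1).
by rewrite (int_cst mO P1).
Qed.

Lemma bmeas_D1Gamma f g : bmeas Om f -> bmeas Om' g ->
  bmeas Om (D1Gamma Q c eps f g).
Proof.
move=> bf bg; have br := bmeas_residual bf bg.
apply: eq_bmeas (bmeas_int1 P Q mO mO' br) => x Ox.
by rewrite D1GammaE.
Qed.

Lemma bmeas_D2Gamma f g : bmeas Om f -> bmeas Om' g ->
  bmeas Om' (D2Gamma P c eps f g).
Proof.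
move=> bf bg; have br := bmeas_residual bf bg.
apply: eq_bmeas (bmeas_int2 P Q mO mO' br) => x Ox.
by rewrite D2GammaE.
Qed.

(** The pairing of the gradient at [(f, g)] with a direction [(a, b)]. *)
Lemma residual_pairing f g a b : bmeas Om f -> bmeas Om' g ->
  bmeas Om a -> bmeas Om' b ->
  \int[PQ]_(z in S) (residual f g z * (a z.1 + b z.2)) =
  \int[P]_(x in Om) (a x * D1Gamma Q c eps f g x) +
  \int[Q]_(y in Om') (b y * D2Gamma P c eps f g y).
Proof.
move=> bf bg ba bb; have br := bmeas_residual bf bg.
have b1 : bmeas S (fun z => residual f g z * a z.1) by bmeas_auto.
have b2 : bmeas S (fun z => residual f g z * b z.2) by bmeas_auto.
have -> : \int[PQ]_(z in S) (residual f g z * (a z.1 + b z.2)) =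
    \int[PQ]_(z in S) (residual f g z * a z.1) +
    \int[PQ]_(z in S) (residual f g z * b z.2).
  rewrite -(@intD _ _ _ (prodP P Q) S mS _ _ b1 b2).
  by apply: eq_int => z _; rewrite mulrDr.
rewrite (int_fubini1 P Q mO mO' b1) (int_fubini2 P Q mO mO' b2); congr (_ + _).
  apply: eq_int => x Ox /=; rewrite D1GammaE//.
  rewrite -(intZ Q mO' _ (bmeas_sec1 mO mO' br Ox)).
  by apply: eq_int => y _; rewrite mulrC.
apply: eq_int => y Oy /=; rewrite D2GammaE//.
rewrite -(intZ P mO _ (bmeas_sec2 mO mO' br Oy)).
by apply: eq_int => x _; rewrite mulrC.
Qed.

Lemma Gamma_ge f g a b : bmeas Om f -> bmeas Om' g ->
  bmeas Om a -> bmeas Om' b ->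
  Gamma P Q c eps f g + \int[PQ]_(z in S) (residual f g z * (a z.1 + b z.2))
  - (2 * eps)^-1 * \int[PQ]_(z in S) ((a z.1 + b z.2) ^+ 2) <=
  Gamma P Q c eps (fun x => f x + a x) (fun y => g y + b y).
Proof.
move=> bf bg ba bb; have br := bmeas_residual bf bg.
have bs := bmeas_slack bf bg.
have bfa : bmeas Om (fun x => f x + a x) by bmeas_auto.
have bgb : bmeas Om' (fun x => g x + b x) by bmeas_auto.
have bs2 := bmeas_slack bfa bgb.
have b0 : bmeas S (fun z => f z.1 + g z.2 - (2 * eps)^-1 * Num.max (slack f g z)
  0 ^+ 2) by bmeas_auto.
have b1 : bmeas S (fun z => residual f g z * (a z.1 + b z.2)) by bmeas_auto.
have b2 : bmeas S (fun z => (a z.1 + b z.2) ^+ 2) by bmeas_auto.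
have b3 : bmeas S (fun z => (2 * eps)^-1 * (a z.1 + b z.2) ^+ 2) by bmeas_auto.
have b4 : bmeas S (fun z => f z.1 + a z.1 + (g z.2 + b z.2) - (2 * eps)^-1 *
  Num.max (slack (fun x => f x + a x) (fun y => g y + b y) z) 0 ^+ 2) by bmeas_auto.
rewrite /Gamma /prod_supp -(@intZ _ _ _ (prodP P Q) S mS _ _ b2).
rewrite -(@intD _ _ _ (prodP P Q) S mS _ _ b0 b1).
rewrite -(@intB _ _ _ (prodP P Q) S mS _ _ (bmeasD b0 b1) b3).
apply: int_le => //; first exact: bmeasB (bmeasD b0 b1) b3.
move=> z _; have := pos_sqr_le (slack f g z) (a z.1 + b z.2).
have -> : slack f g z + (a z.1 + b z.2) =
  slack (fun x => f x + a x) (fun y => g y + b y) z by rewrite /slack; ring.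
rewrite /residual; set p := Num.max (slack f g z) 0.
rewrite -/(slack (fun x => f x + a x) (fun y => g y + b y) z).
set q := Num.max _ 0 => h.
have e2 : 0 <= (2 * eps)^-1 by rewrite invr_ge0 mulr_ge0// ltW.
have := ler_wpM2l e2 h.
have -> : eps^-1 = 2 * (2 * eps)^-1 by field; rewrite gt_eqF.
move: (2 * eps)^-1 => k; lra.
Qed.

Lemma Gamma_le f g a b : bmeas Om f -> bmeas Om' g ->
  bmeas Om a -> bmeas Om' b ->
  Gamma P Q c eps (fun x => f x + a x) (fun y => g y + b y) <=
  Gamma P Q c eps f g + \int[PQ]_(z in S) (residual f g z * (a z.1 + b z.2)).
Proof.
move=> bf bg ba bb; have br := bmeas_residual bf bg.
have bs := bmeas_slack bf bg.
have bfa : bmeas Om (fun x => f x + a x) by bmeas_auto.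
have bgb : bmeas Om' (fun x => g x + b x) by bmeas_auto.
have bs2 := bmeas_slack bfa bgb.
have b0 : bmeas S (fun z => f z.1 + g z.2 - (2 * eps)^-1 * Num.max (slack f g z)
  0 ^+ 2) by bmeas_auto.
have b1 : bmeas S (fun z => residual f g z * (a z.1 + b z.2)) by bmeas_auto.
have b4 : bmeas S (fun z => f z.1 + a z.1 + (g z.2 + b z.2) - (2 * eps)^-1 *
  Num.max (slack (fun x => f x + a x) (fun y => g y + b y) z) 0 ^+ 2) by bmeas_auto.
rewrite /Gamma /prod_supp -(@intD _ _ _ (prodP P Q) S mS _ _ b0 b1).
apply: int_le => //; first exact: bmeasD b0 b1.
move=> z _; have := pos_sqr_ge (slack f g z) (a z.1 + b z.2).
have -> : slack f g z + (a z.1 + b z.2) =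
  slack (fun x => f x + a x) (fun y => g y + b y) z by rewrite /slack; ring.
rewrite /residual; set p := Num.max (slack f g z) 0.
rewrite -/(slack (fun x => f x + a x) (fun y => g y + b y) z).
set q := Num.max _ 0 => h.
have e2 : 0 <= (2 * eps)^-1 by rewrite invr_ge0 mulr_ge0// ltW.
have := ler_wpM2l e2 h.
have -> : eps^-1 = 2 * (2 * eps)^-1 by field; rewrite gt_eqF.
move: (2 * eps)^-1 => k; lra.
Qed.

Variables (fs gs : Rd -> R).
Hypotheses (bfs : bmeas Om fs) (bgs : bmeas Om' gs)
  (potentials : dual_maximizer P Q c eps fs gs).

(** Stationarity of the maximizer, tested against bounded directions: the
second-order loss in [Gamma_ge] is quadratic in the step. *)
Lemma first_order a b : bmeas Om a -> bmeas Om' b ->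
  \int[PQ]_(z in S) (residual fs gs z * (a z.1 + b z.2)) = 0.
Proof.
move=> ba bb; have br := bmeas_residual bfs bgs.
have b1 : bmeas S (fun z => residual fs gs z * (a z.1 + b z.2)) by bmeas_auto.
have b2 : bmeas S (fun z => (a z.1 + b z.2) ^+ 2) by bmeas_auto.
apply: (@linear_le_quadratic _ _ ((2 * eps)^-1 * \int[PQ]_(z in S) ((a z.1 + b
  z.2) ^+ 2))).
  rewrite mulr_ge0 ?invr_ge0 ?mulr_ge0 ?(ltW eps_gt0)//.
  by apply: Rintegral_ge0 => z _; exact: sqr_ge0.
move=> t.
have bta : bmeas Om (fun x => t * a x) by bmeas_auto.
have btb : bmeas Om' (fun x => t * b x) by bmeas_auto.
have := Gamma_ge bfs bgs bta btb.
have -> : \int[PQ]_(z in S) (residual fs gs z * (t * a z.1 + t * b z.2)) =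
  t * \int[PQ]_(z in S) (residual fs gs z * (a z.1 + b z.2)).
  rewrite -(@intZ _ _ _ (prodP P Q) S mS _ _ b1); apply: eq_int => z _; ring.
have -> : \int[PQ]_(z in S) ((t * a z.1 + t * b z.2) ^+ 2) =
  t ^+ 2 * \int[PQ]_(z in S) ((a z.1 + b z.2) ^+ 2).
  rewrite -(@intZ _ _ _ (prodP P Q) S mS _ _ b2); apply: eq_int => z _; ring.
case: potentials => _ _ /(_ (fun x => fs x + t * a x) (fun x => gs x + t * b x)).
move=> /(_ (L2fun_bmeas P mO _) (L2fun_bmeas Q mO' _)) H H2.
have {}H : Gamma P Q c eps (fun x => fs x + t * a x) (fun x => gs x + t * b x) <=
  Gamma P Q c eps fs gs by apply: H; bmeas_auto.
by move: (le_trans H2 H); rewrite lerBlDr lerD2l mulrCA.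
Qed.

End dual.

(** * Gradient domination *)

Section polyak_lojasiewicz.
Context (R : realType) (d : nat).
Local Notation Rd := 'rV[R]_d.
Variables (P Q : probability Rd R) (c : Rd -> Rd -> R) (eps : R).
Hypothesis eps_gt0 : 0 < eps.
Local Notation Om := (msupport P).
Local Notation Om' := (msupport Q).
Local Notation S := (Om `*` Om').
Local Notation PQ := (P \x Q)%E.
Hypothesis bc : bmeas S (fun z => c z.1 z.2).
Variables (fs gs f g : Rd -> R) (w : Rd * Rd -> R) (M C : R).
Hypotheses (bfs : bmeas Om fs) (bgs : bmeas Om' gs)
  (bf : bmeas Om f) (bg : bmeas Om' g) (bw : bmeas S w).
Hypothesis stationary : forall a b, bmeas Om a -> bmeas Om' b ->
  \int[PQ]_(z in S) (residual c eps fs gs z * (a z.1 + b z.2)) = 0.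
Hypotheses (M_eps : eps <= M)
  (M_bound : forall z, S z -> `|(f z.1 - fs z.1) + (g z.2 - gs z.2)| <= M)
  (w_slack : forall z, S z ->
     w z = 0 \/ w z = 1 /\ eps / 2 <= slack c fs gs z).
Hypotheses (C_gt0 : 0 < C) (poincare : forall u v, bmeas Om u -> bmeas Om' v ->
  \int[P]_(x in Om) u x = 0 ->
  \int[PQ]_(z in S) (u z.1 + v z.2) ^+ 2 <=
  C * \int[PQ]_(z in S) (w z * (u z.1 + v z.2) ^+ 2)).

Let mO : measurable Om := measurable_msupport P.
Let mO' : measurable Om' := measurable_msupport Q.
Let P1 : P Om = 1%E := probability_msupport P.
Let Q1 : Q Om' = 1%E := probability_msupport Q.
Let mS : measurable S. Proof. exact: measurableX. Qed.

Let D z := (f z.1 - fs z.1) + (g z.2 - gs z.2).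
(** Minus the derivative of [Gamma] at [(f, g)] in the direction [D]. *)
Let X := - \int[PQ]_(z in S) (residual c eps f g z * D z).
Let N2 := \int[PQ]_(z in S) (D z ^+ 2).
Let D1 := D1Gamma Q c eps f g.
Let D2 := D2Gamma P c eps f g.
Let m2 := \int[P]_(x in Om) (D1 x ^+ 2) + \int[Q]_(y in Om') (D2 y ^+ 2).
Let K := 2 * M * C.

Let bD : bmeas S D. Proof. by rewrite /D; bmeas_auto. Qed.

Let M_gt0 : 0 < M. Proof. exact: lt_le_trans M_eps. Qed.

Let K_gt0 : 0 < K. Proof. by rewrite /K !mulr_gt0. Qed.

(** Moving a constant from one component to the other leaves [D] unchanged; the
normalization makes the first component have mean zero. *)
Let ubar := \int[P]_(x in Om) (f x - fs x).
Let u x := f x - fs x - ubar.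
Let v y := g y - gs y + ubar.

Let bu : bmeas Om u. Proof. by rewrite /u; bmeas_auto. Qed.
Let bv : bmeas Om' v. Proof. by rewrite /v; bmeas_auto. Qed.

Let u_mean : \int[P]_(x in Om) u x = 0.
Proof.
have b0 : bmeas Om (fun x => f x - fs x) by bmeas_auto.
by rewrite /u (intB P mO b0 (bmeas_cst _ _)) int_cst// subrr.
Qed.

Let DE z : D z = u z.1 + v z.2. Proof. by rewrite /D /u /v; ring. Qed.

Let N2E : N2 = \int[P]_(x in Om) (u x ^+ 2) + \int[Q]_(y in Om') (v y ^+ 2).
Proof.
rewrite -(sqr_osum_mean0 bu bv u_mean) /N2.
by apply: eq_int => z _; rewrite DE.
Qed.

(** Subtracting the stationarity of the potentials turns [X] into the integral of a
monotone difference, bounded below where the slack is large. *)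
Let X_ge : N2 <= K * X.
Proof.
have bwD : bmeas S (fun z => w z * D z ^+ 2) by bmeas_auto.
have br := bmeas_residual eps bc bf bg.
have brs := bmeas_residual eps bc bfs bgs.
have H : (2 * M)^-1 * \int[PQ]_(z in S) (w z * D z ^+ 2) <= X.
  have -> : X = \int[PQ]_(z in S)
      (residual c eps fs gs z * D z - residual c eps f g z * D z).
    have b1 : bmeas S (fun z => residual c eps fs gs z * D z) by bmeas_auto.
    have b2 : bmeas S (fun z => residual c eps f g z * D z) by bmeas_auto.
    rewrite (@intB _ _ _ (prodP P Q) S mS _ _ b1 b2).
    rewrite (_ : \int[prodP P Q]_(z in S) (residual c eps fs gs z * D z) = 0) ?sub0r//.
    by rewrite -(stationary bu bv); apply: eq_int => z _; rewrite DE.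
  rewrite -(@intZ _ _ _ (prodP P Q) S mS _ _ bwD).
  apply: int_le => //; try by bmeas_auto.
  move=> z Sz; rewrite -mulrBl /residual.
  have Dz : D z = slack c f g z - slack c fs gs z by rewrite /D /slack; ring.
  have -> : 1 - eps^-1 * Num.max (slack c fs gs z) 0 -
      (1 - eps^-1 * Num.max (slack c f g z) 0) =
    eps^-1 * (Num.max (slack c f g z) 0 - Num.max (slack c fs gs z) 0) by ring.
  have := M_bound Sz; rewrite -/(D z) Dz => Mz.
  have [->|[-> es]] := w_slack Sz.
    rewrite mul0r mulr0 -mulrA mulr_ge0 ?invr_ge0 ?(ltW eps_gt0)//.
    exact: pos_monotone.
  rewrite mul1r; exact: (pos_monotone_ge eps_gt0 M_eps).
have := poincare bu bv u_mean.
under eq_int do rewrite -DE.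
have -> : \int[PQ]_(z in S) (w z * (u z.1 + v z.2) ^+ 2) =
  \int[PQ]_(z in S) (w z * D z ^+ 2) by apply: eq_int => z _; rewrite DE.
move=> h; apply: (le_trans h).
rewrite /K mulrC -mulrA [C * _]mulrC mulrA ler_wpM2r ?(ltW C_gt0)//.
by rewrite -ler_pdivrMl ?mulr_gt0.
Qed.

Let X_young : 2 * K * X <= N2 + K ^+ 2 * m2.
Proof.
have b1 := bmeas_D1Gamma eps bc bf bg.
have b2 := bmeas_D2Gamma eps bc bf bg.
have -> : X = - (\int[P]_(x in Om) (u x * D1 x) + \int[Q]_(y in Om') (v y * D2 y)).
  rewrite -(residual_pairing eps bc bf bg bu bv) /X; congr (- _).
  by apply: eq_int => z _; rewrite DE.
have young (a h : R) : - (2 * K) * (a * h) <= a ^+ 2 + K ^+ 2 * h ^+ 2.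
  by have := sqr_ge0 (a + K * h); rewrite sqrrD exprMn; lra.
have Y1 : - (2 * K) * \int[P]_(x in Om) (u x * D1 x) <=
    \int[P]_(x in Om) (u x ^+ 2) + K ^+ 2 * \int[P]_(x in Om) (D1 x ^+ 2).
  have c1 : bmeas Om (fun x => u x * D1 x) by bmeas_auto.
  have c2 : bmeas Om (fun x => u x ^+ 2) by bmeas_auto.
  have c3 : bmeas Om (fun x => D1 x ^+ 2) by bmeas_auto.
  have c4 : bmeas Om (fun x => K ^+ 2 * D1 x ^+ 2) by bmeas_auto.
  rewrite -(intZ P mO _ c1) -(intZ P mO _ c3) -(intD P mO c2 c4).
  by apply: int_le => //; bmeas_auto.
have Y2 : - (2 * K) * \int[Q]_(x in Om') (v x * D2 x) <=
    \int[Q]_(x in Om') (v x ^+ 2) + K ^+ 2 * \int[Q]_(x in Om') (D2 x ^+ 2).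
  have c1 : bmeas Om' (fun x => v x * D2 x) by bmeas_auto.
  have c2 : bmeas Om' (fun x => v x ^+ 2) by bmeas_auto.
  have c3 : bmeas Om' (fun x => D2 x ^+ 2) by bmeas_auto.
  have c4 : bmeas Om' (fun x => K ^+ 2 * D2 x ^+ 2) by bmeas_auto.
  rewrite -(intZ Q mO' _ c1) -(intZ Q mO' _ c3) -(intD Q mO' c2 c4).
  by apply: int_le => //; bmeas_auto.
rewrite N2E /m2 mulrN -mulNr mulrDr (mulrDr (K ^+ 2)) addrACA.
exact: lerD Y1 Y2.
Qed.

(** The squared distance in [L2] of the direct sums is bounded by the squared norm
of the gradient. *)
Lemma distance_le_gradient : N2 <= K ^+ 2 * m2.
Proof.
have := X_ge; have := X_young; rewrite -mulrA; move: (K * X) (K ^+ 2 * m2) N2.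
by move=> a b e; lra.
Qed.

(** The dual gap is bounded by the squared norm of the gradient. *)
Lemma gap_le_gradient : Gamma P Q c eps fs gs - Gamma P Q c eps f g <= K * m2.
Proof.
have bnu : bmeas Om (fun x => fs x - f x) by bmeas_auto.
have bnv : bmeas Om' (fun x => gs x - g x) by bmeas_auto.
have := Gamma_le eps_gt0 bc bf bg bnu bnv.
rewrite (_ : (fun x => f x + (fs x - f x)) = fs); last by apply/funext => x;
  rewrite addrC subrK.
rewrite (_ : (fun x => g x + (gs x - g x)) = gs); last by apply/funext => x;
  rewrite addrC subrK.
rewrite -lerBlDl => /le_trans; apply.
apply: (@le_trans _ _ X).
  rewrite /X -mulN1r -(@intZ _ _ _ (prodP P Q) S mS); last first.
    by have br := bmeas_residual eps bc bf bg; bmeas_auto.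
  rewrite le_eqVlt; apply/orP; left; apply/eqP; apply: eq_int => z _.
  by rewrite /D; ring.
rewrite -(ler_pM2l K_gt0) mulrA -expr2.
have := distance_le_gradient; have := X_young; rewrite -mulrA; move: (K * X) (K
  ^+ 2 * m2) N2.
by move=> a b e; lra.
Qed.

End polyak_lojasiewicz.

Section continuity.
Context (R : realType) (d : nat).
Local Notation Rd := 'rV[R]_d.

(** A continuous function orthogonal to all bounded functions vanishes everywhere
on the support: test it against the indicator of a small ball, whose mass is
positive. *)
Lemma orthogonal_continuous_eq0 (mu : probability Rd R) (h : Rd -> R) (x0 : Rd) :
  bmeas (msupport mu) h ->
  (forall a, bmeas (msupport mu) a -> \int[mu]_(x in msupport mu) (a x * h x) = 0) ->
  msupport mu x0 ->
  (forall e, 0 < e -> exists2 s : R, 0 < s & forall x, msupport mu x ->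
     enorm (x - x0) < s -> `|h x - h x0| <= e) ->
  h x0 = 0.
Proof.
move=> bh orth Sx0 cont; apply/eqP/negP => /negP h0.
have mS := measurable_msupport mu.
have n0 : 0 < `|h x0| by rewrite normr_gt0.
have [s s0 sP] := cont (`|h x0| / 2) (divr_gt0 n0 (ltr0n _ 2)).
have bi : bmeas (msupport mu) (\1_(eball x0 s) : Rd -> R).
  by apply: bmeas_indic; exact: measurable_eball.
have ba : bmeas (msupport mu) (fun x => h x0 * \1_(eball x0 s) x) by bmeas_auto.
have : \int[mu]_(x in msupport mu) (h x0 ^+ 2 / 2 * \1_(eball x0 s) x) <= 0.
  rewrite -(orth _ ba); apply: int_le => //; [by bmeas_auto|by bmeas_auto|].
  move=> x Sx; rewrite indicE; case: (boolP (x \in _)) => [/set_mem xB|_].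
    rewrite !mulr1; have := sP x Sx xB.
    rewrite ler_norml => /andP[h1 h2].
    have [hx0|hx0] := lerP 0 (h x0).
      by rewrite ger0_norm// in h1 h2; rewrite expr2 -mulrA ler_wpM2l//; lra.
    by rewrite ltr0_norm// in h1 h2; rewrite expr2 -mulrA ler_wnM2l ?(ltW hx0)//; lra.
  by rewrite !mulr0 mul0r.
rewrite (intZ mu mS _ bi) (int_indic _ mS); last exact: measurable_eball.
rewrite (probability_setI_full mS (probability_msupport mu)); last exact:
  measurable_eball.
apply/negP; rewrite -ltNge mulr_gt0 ?divr_gt0 ?exprn_even_gt0//.
rewrite -lte_fin fineK ?fin_num_measure//; last exact: measurable_eball.
apply: Sx0; first exact: open_eball.
by rewrite /eball /= subrr enorm0.
Qed.

Lemma int_pos (disp : measure_display) (T : measurableType disp)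
    (mu : probability T R) (A : set T) (k : T -> R) :
  measurable A -> mu A = 1%E -> bmeas A k -> (forall x, A x -> 0 < k x) ->
  0 < \int[mu]_(x in A) k x.
Proof.
move=> mA A1 bk k0; rewrite lt_neqAle Rintegral_ge0 ?andbT; last first.
  by move=> x Ax; exact/ltW/k0.
apply/negP => /eqP i0.
have : (\int[mu]_(x in A) `|(k x)%:E| = 0)%E.
  rewrite -[RHS]/(0%R%:E) i0 EFin_int//; apply: eq_integral => x /set_mem Ax.
  by rewrite gee0_abs// lee_fin ltW// k0.
have mk : measurable_fun A (EFin \o k) by apply/measurable_EFinP; case: bk.
move=> /(ae_eq_integral_abs mu mA mk) [N [mN N0 AN]].
have : (mu A <= mu N)%E.
  apply: le_measure; rewrite ?inE// => x Ax; apply: AN => /= /(_ Ax) [kx].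
  by have := k0 x Ax; rewrite kx ltxx.
by rewrite [X in (_ <= X)%E]N0 [X in (X <= _)%E]A1 lee_fin ler10.
Qed.

(** The positive part of [t (x0, _)] has mean exactly [eps], so it cannot be
smaller than [eps] on the whole support. *)
Lemma exists_slack_ge (P Q : probability Rd R) (t : Rd * Rd -> R) (eps : R) :
  0 < eps -> bmeas (msupport P `*` msupport Q) t ->
  (forall x0 e, msupport P x0 -> 0 < e -> exists2 s : R, 0 < s &
     forall x y, msupport P x -> msupport Q y -> enorm (x - x0) < s ->
       `|t (x, y) - t (x0, y)| <= e) ->
  (forall a, bmeas (msupport P) a ->
     \int[P]_(x in msupport P)
       (a x * (\int[Q]_(y in msupport Q) (1 - eps^-1 * Num.max (t (x, y)) 0))) = 0) ->
  forall x0, msupport P x0 -> exists2 y0, msupport Q y0 & eps <= t (x0, y0).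
Proof.
move=> e0 bt cont orth x0 Sx0.
have mP := measurable_msupport P.
have mQ := measurable_msupport Q.
have br : bmeas (msupport P `*` msupport Q) (fun z => 1 - eps^-1 * Num.max (t z)
  0) by bmeas_auto.
have bh := bmeas_int1 P Q mP mQ br.
have := orthogonal_continuous_eq0 bh orth Sx0.
have bs x (Sx : msupport P x) := bmeas_sec1 mP mQ br Sx.
move=> H; have {}H : \int[Q]_(y in msupport Q) (1 - eps^-1 * Num.max (t (x0, y)) 0) = 0.
  apply: H => e e0'.
  have [s s0 sP] := cont x0 (eps * e) Sx0 (mulr_gt0 e0 e0').
  exists s => // x Sx xs; rewrite -(intB Q mQ (bs _ Sx) (bs _ Sx0)).
  apply: le_trans (le_normr_Rintegral mQ (bmeas_integrable Q mQ (bmeasB (bs _ Sx)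
    (bs _ Sx0)))) _.
  rewrite -[leRHS](int_cst mQ (probability_msupport Q)).
  apply: int_le => //.
  - have [mb [M bM]] := bmeasB (bs _ Sx) (bs _ Sx0).
    split; first exact: measurableT_comp.
    by exists M => y Sy; rewrite normr_id; exact: bM.
  - exact: bmeas_cst.
  move=> y Sy.
  have -> : 1 - eps^-1 * Num.max (t (x, y)) 0 - (1 - eps^-1 * Num.max (t (x0, y)) 0) =
    eps^-1 * (Num.max (t (x0, y)) 0 - Num.max (t (x, y)) 0) by ring.
  rewrite normrM gtr0_norm ?invr_gt0// ler_pdivrMl//.
  apply: le_trans (sP x y Sx Sy xs).
  rewrite -[leRHS]normrN opprB.
  case: (lerP (t (x0, y)) 0) => h1; case: (lerP (t (x, y)) 0) => h2;
    rewrite ?subrr ?normr0 ?normr_ge0 ?subr0 ?sub0r ?normrN//.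
    rewrite gtr0_norm// ler_normr; apply/orP; right; lra.
  rewrite gtr0_norm// ler_normr; apply/orP; left; lra.
apply: contrapT => /forall2NP no.
have : 0 < \int[Q]_(y in msupport Q) (1 - eps^-1 * Num.max (t (x0, y)) 0).
  apply: int_pos => //; [exact: probability_msupport|exact: bs|].
  move=> y Sy; have [//|/negP] := no y; rewrite -ltNge => ty.
  rewrite subr_gt0 ltr_pdivrMl// mulr1.
  by case: (lerP (t (x0, y)) 0).
by rewrite H ltxx.
Qed.

End continuity.

(** * The primal value is at most the dual maximum *)

Section density_probability.
Context (R : realType) (disp : measure_display) (T : measurableType disp).
Variables (mu : {measure set T -> \bar R}) (p : T -> R).

(** The probability of density [p] with respect to [mu].  The proofs are arguments
of the definition so that the measure structure can be inferred from it. *)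
Definition density_probability (mp : measurable_fun setT p)
    (p_ge0 : forall x, 0 <= p x) (p1 : (\int[mu]_x (p x)%:E = 1)%E) :
  set T -> \bar R := fun A => (\int[mu]_(x in A) (p x)%:E)%E.

Variables (mp : measurable_fun setT p) (p_ge0 : forall x, 0 <= p x)
  (p1 : (\int[mu]_x (p x)%:E = 1)%E).
Local Notation nu := (density_probability mp p_ge0 p1).

Let nu0 : nu set0 = 0%E.
Proof. exact: integral_set0. Qed.

Let nu_ge0 A : (0 <= nu A)%E.
Proof. by apply: integral_ge0 => x _; rewrite lee_fin. Qed.

Let nu_sigma_additive : semi_sigma_additive nu.
Proof.
apply: semi_sigma_additive_nng_induced => [|x]; last by rewrite lee_fin.
exact/measurable_EFinP.
Qed.

HB.instance Definition _ := isMeasure.Build _ _ _ nu nu0 nu_ge0 nu_sigma_additive.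

Let nu1 : nu setT = 1%E. Proof. exact: p1. Qed.

HB.instance Definition _ := Measure_isProbability.Build _ _ _ nu nu1.

End density_probability.

Section strong_duality.
Context (R : realType) (d : nat).
Local Notation Rd := 'rV[R]_d.
Variables (P Q : probability Rd R) (c : Rd -> Rd -> R) (eps : R).
Hypothesis eps_gt0 : 0 < eps.
Local Notation Om := (msupport P).
Local Notation Om' := (msupport Q).
Local Notation S := (Om `*` Om').
Local Notation PQ := (prodP P Q).
Hypothesis bc : bmeas S (fun z => c z.1 z.2).
Variables (fs gs : Rd -> R).
Hypotheses (bfs : bmeas Om fs) (bgs : bmeas Om' gs).
Hypothesis stationary : forall a b, bmeas Om a -> bmeas Om' b ->
  \int[PQ]_(z in S) (residual c eps fs gs z * (a z.1 + b z.2)) = 0.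

Let mO : measurable Om := measurable_msupport P.
Let mO' : measurable Om' := measurable_msupport Q.
Let mS : measurable S. Proof. exact: measurableX. Qed.
Let S1 : PQ S = 1%E. Proof. exact: prod_supp_full. Qed.

Let m z := Num.max (slack c fs gs z) 0.
Let q z := eps^-1 * m z.
Let p := q \_ S.

Let bmm : bmeas S m.
Proof. by apply: bmeas_max0; exact: bmeas_slack. Qed.

Let bq : bmeas S q. Proof. by rewrite /q; bmeas_auto. Qed.

Let p_ge0 z : 0 <= p z.
Proof.
rewrite /p patchE; case: ifPn => // _.
by rewrite /q mulr_ge0 ?invr_ge0 ?(ltW eps_gt0)// /m le_max lexx orbT.
Qed.

Let bp : bmeas setT p.
Proof.
split; first by apply/(measurable_restrictT _ mS); case: bq.
have [_ [M qM]] := bq; exists (Num.max M 0) => z _.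
rewrite /p patchE; case: ifPn => [/set_mem /qM h|_].
  by rewrite le_max h.
by rewrite normr0 le_max lexx orbT.
Qed.

Let mp : measurable_fun setT p. Proof. by case: bp. Qed.

Let int_pE A (h : Rd * Rd -> R) : measurable A -> bmeas setT h ->
  (\int[PQ]_(z in A) (h z * p z)%:E)%E =
  (\int[PQ]_(z in S) (\1_A z * (h z * q z)))%:E.
Proof.
move=> mA bh.
have bi : bmeas S (\1_A : _ -> R) by exact: bmeas_indic.
have bhS : bmeas S h by apply: bmeasS bh.
rewrite EFin_int//; last by bmeas_auto.
rewrite integral_mkcond [RHS]integral_mkcond; apply: eq_integral => z _.
rewrite /p !patchE indicE.
by case: (z \in A); case: (z \in S); rewrite /= ?mul1r ?mul0r ?mulr0.
Qed.

(** Stationarity says that [q] and 1 have the same integral against direct sums;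
for functions of one coordinate this is the marginal condition. *)
Let int_q a b : bmeas Om a -> bmeas Om' b ->
  \int[PQ]_(z in S) ((a z.1 + b z.2) * q z) =
  \int[PQ]_(z in S) (a z.1 + b z.2).
Proof.
move=> ba bb; apply/eqP; rewrite eq_sym -subr_eq0; apply/eqP.
have b1 : bmeas S (fun z => a z.1 + b z.2) by bmeas_auto.
have b2 : bmeas S (fun z => (a z.1 + b z.2) * q z) by bmeas_auto.
rewrite -(intB PQ mS b1 b2) -[RHS](stationary ba bb).
by apply: eq_int => z _; rewrite /residual -/(m z) -/(q z); ring.
Qed.

Let p1 : (\int[PQ]_z (p z)%:E = 1)%E.
Proof.
have -> : (\int[PQ]_z (p z)%:E = \int[PQ]_z (1 * p z)%:E)%E.
  by apply: eq_integral => z _; rewrite mul1r.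
rewrite (int_pE measurableT (bmeas_cst _ 1)).
have := int_q (bmeas_cst Om 1) (bmeas_cst Om' 0).
rewrite addr0 (int_cst mS S1) => h; rewrite -[RHS]/(1%R%:E) -[in RHS]h; congr EFin.
by apply: eq_int => z _; rewrite indicE in_setT !mul1r.
Qed.

Let pi : probability (Rd * Rd)%type R := density_probability mp p_ge0 p1.

Let piE A : pi A = (\int[PQ]_(z in A) (p z)%:E)%E. Proof. by []. Qed.

Let pi_coupling : coupling P Q pi.
Proof.
have H A : measurable A -> pi A = (\int[PQ]_(z in S) (\1_A z * q z))%:E.
  move=> mA; rewrite piE.
  have -> : (\int[PQ]_(z in A) (p z)%:E = \int[PQ]_(z in A) (1 * p z)%:E)%E.
    by apply: eq_integral => z _; rewrite mul1r.
  rewrite (int_pE mA (bmeas_cst _ 1)); congr EFin.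
  by apply: eq_int => z _; rewrite mul1r.
split=> A mA.
  have mA' : measurable (fst @^-1` A : set (Rd * Rd)).
    by rewrite -[X in measurable X]setTI; exact: measurable_fst.
  rewrite H//.
  have bA : bmeas Om (\1_A : Rd -> R) by exact: bmeas_indic.
  have bi : bmeas S (fun z => \1_A z.1 : R) by bmeas_auto.
  have := int_q bA (bmeas_cst Om' 0).
  under eq_int do rewrite addr0.
  under [in RHS]eq_int do rewrite addr0.
  rewrite [RHS](int_fubini1 P Q mO mO' bi) /=.
  rewrite [RHS](@eq_int _ _ _ P Om _ (\1_A : Rd -> R)); last first.
    by move=> x _; rewrite int_cst//; exact: probability_msupport.
  rewrite int_indic// (probability_setI_full mO (probability_msupport P) mA).
  rewrite (_ : \int[PQ]_(z in S) (\1_(fst @^-1` A) z * q z) = \int[PQ]_(z in S)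
    (\1_A z.1 * q z)); last first.
    by apply: eq_int => z _; rewrite !indicE.
  by move=> ->; rewrite fineK// fin_num_measure.
have mA' : measurable (snd @^-1` A : set (Rd * Rd)).
  by rewrite -[X in measurable X]setTI; exact: measurable_snd.
rewrite H//.
have bA : bmeas Om' (\1_A : Rd -> R) by exact: bmeas_indic.
have bi : bmeas S (fun z => \1_A z.2 : R) by bmeas_auto.
have := int_q (bmeas_cst Om 0) bA.
under eq_int do rewrite add0r.
under [in RHS]eq_int do rewrite add0r.
rewrite [RHS](int_fubini2 P Q mO mO' bi) /=.
rewrite [RHS](@eq_int _ _ _ Q Om' _ (\1_A : Rd -> R)); last first.
  by move=> x _; rewrite int_cst//; exact: probability_msupport.
rewrite int_indic// (probability_setI_full mO' (probability_msupport Q) mA).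
rewrite (_ : \int[PQ]_(z in S) (\1_(snd @^-1` A) z * q z) = \int[PQ]_(z in S)
  (\1_A z.2 * q z)); last first.
  by apply: eq_int => z _; rewrite !indicE.
by move=> ->; rewrite fineK// fin_num_measure.
Qed.

Let pi_dom : pi `<< PQ.
Proof.
apply/null_content_dominatesP => A mA A0; rewrite piE.
apply: null_set_integral => //.
by apply: measurable_funTS; exact/measurable_EFinP.
Qed.

Local Notation RN := (Radon_Nikodym (charge_of_finite_measure pi) PQ).

Let mRN : measurable_fun setT RN.
Proof.
have i := @Radon_Nikodym_integrable _ _ _ (charge_of_finite_measure pi) PQ pi_dom.
exact: measurable_int i.
Qed.

(** The Radon-Nikodym derivative is determined almost everywhere, hence agrees
with the density that defines the measure. *)
Let RN_ae : ae_eq PQ setT (EFin \o p) RN.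
Proof.
apply: integral_ae_eq => //.
- exact: bmeas_integrable.
- by move=> E _ mE; rewrite -Radon_Nikodym_integral.
Qed.

Let RN_norm : (Lnorm PQ 2%:E RN ^+ 2 = (\int[PQ]_(z in S) q z ^+ 2)%:E)%E.
Proof.
have -> : Lnorm PQ 2%:E RN = L2norm PQ S q.
  rewrite /L2norm unlock; congr (_ `^ _)%E.
  rewrite restrict_EFin -/p; apply: ge0_ae_eq_integral => //.
  - apply: (@measurableT_comp _ _ _ _ _ _ (fun x : \bar R => (x `^ 2)%E)) => //=.
      exact: measurable_poweR.
    exact: measurableT_comp mRN.
  - apply: (@measurableT_comp _ _ _ _ _ _ (fun x : \bar R => (x `^ 2)%E)) => //=.
      exact: measurable_poweR.
    by apply/measurable_EFinP; exact: measurableT_comp mp.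
  - by move=> z _; exact: poweR_ge0.
  - by move=> z _; exact: poweR_ge0.
  - by move: RN_ae; apply: filterS => z h _; rewrite -(h I).
rewrite (L2norm_bmeas PQ mS bq) -EFin_expe sqr_sqrtr// Rintegral_ge0// => z _.
exact: sqr_ge0.
Qed.

Let RN_cost : (\int[pi]_(z in S) (c z.1 z.2)%:E =
  (\int[PQ]_(z in S) (c z.1 z.2 * q z))%:E)%E.
Proof.
have bcq : bmeas S (fun z => c z.1 z.2 * q z) by bmeas_auto.
rewrite EFin_int// -(Radon_Nikodym_change_of_variables pi_dom mS); last first.
  by apply: (@bmeas_integrable _ _ _ pi S mS (fun z => c z.1 z.2)).
have mc : measurable_fun S (fun z => (c z.1 z.2)%:E).
  by apply/measurable_EFinP; case: bc.
apply: ae_eq_integral => //.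
- by apply: emeasurable_funM => //; exact: measurable_funTS.
- by apply/measurable_EFinP; case: bcq.
- by move: RN_ae; apply: filterS => z h Sz; rewrite -(h I) /p /= patchE mem_set.
Qed.

Lemma QOT_le_Gamma : (QOT P Q c eps <= (Gamma P Q c eps fs gs)%:E)%E.
Proof.
apply: (@le_trans _ _ (qot_cost P Q c eps pi)).
  by apply: ereal_inf_lbound; exists pi => //; exact: pi_coupling.
rewrite /qot_cost asboolT; last exact: pi_dom.
rewrite /prod_supp RN_cost RN_norm -EFinM -EFinD lee_fin.
have bb : bmeas S (fun z => c z.1 z.2 * q z) by bmeas_auto.
have bq2 : bmeas S (fun z => q z ^+ 2) by bmeas_auto.
have be : bmeas S (fun z => eps / 2 * q z ^+ 2) by bmeas_auto.
have bs : bmeas S (fun z => fs z.1 + gs z.2) by bmeas_auto.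
have bsq : bmeas S (fun z => (fs z.1 + gs z.2) * q z) by bmeas_auto.
have bm2 : bmeas S (fun z => (2 * eps)^-1 * m z ^+ 2) by bmeas_auto.
rewrite -(intZ PQ mS _ bq2) -(intD PQ mS bb be) /Gamma /prod_supp.
rewrite (intB PQ mS bs bm2) -(int_q bfs bgs) -(intB PQ mS bsq bm2).
rewrite le_eqVlt; apply/orP; left; apply/eqP; apply: eq_int => z _.
have sm : slack c fs gs z * m z = m z ^+ 2.
  by rewrite /m; case: (lerP (slack c fs gs z) 0) => _; rewrite ?mulr0 ?expr0n.
have -> : fs z.1 + gs z.2 = slack c fs gs z + c z.1 z.2 by rewrite /slack; ring.
have -> : (slack c fs gs z + c z.1 z.2) * q z =
  eps^-1 * (slack c fs gs z * m z) + c z.1 z.2 * q z by rewrite /q; ring.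
rewrite sm /q; field.
by rewrite gt_eqF.
Qed.

End strong_duality.

(** * Bounds on the data, the radius and the mass of balls *)

Section bounded_data.
Context (R : realType) (d : nat).
Local Notation Rd := 'rV[R]_d.

Lemma Loofun_bmeas (A : set Rd) (h : Rd -> R) : Loofun A h -> bmeas A h.
Proof.
move=> [mh [M [_ HM]]]; split => //; exists (M + 1) => x Ax.
by apply: HM => //; rewrite ltrDl.
Qed.

Lemma modulus_bmeas (A : set Rd) (h : Rd -> R) (omega : R -> R) : compact A ->
  A !=set0 -> modulus omega -> measurable_fun A h -> has_modulus A h omega ->
  bmeas A h.
Proof.
move=> cA [x0 Ax0] [_ om _ _] mh hm; split => //.
exists (`|h x0| + omega (ediam A)) => x Ax.
rewrite -[h x](subrKC (h x0)) (le_trans (ler_normD _ _))// lerD2l.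
by rewrite (le_trans (hm _ _ Ax Ax0))// om ?enorm_ge0 ?ediam_ub.
Qed.

Variables (P Q : probability Rd R) (c : Rd -> Rd -> R) (omega : R -> R).
Hypotheses (cP : compact (msupport P)) (cQ : compact (msupport Q))
  (om : modulus omega)
  (c_modulus : cost_modulus (msupport P) (msupport Q) c omega).

Lemma cost_bmeas : bmeas (msupport P `*` msupport Q) (fun z => c z.1 z.2).
Proof.
split; last first.
  have [x0 Ox0] := msupport_nonempty P.
  have [y0 Oy0] := msupport_nonempty Q.
  exists (`|c x0 y0| + omega (ediam (msupport P) + ediam (msupport Q))).
  move=> [x y] [/= Ox Oy].
  rewrite -[c x y](subrKC (c x0 y0)) (le_trans (ler_normD _ _))// lerD2l.
  rewrite (le_trans (c_modulus Ox Ox0 Oy Oy0))//; case: om => _ mon _ _.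
  by rewrite mon ?addr_ge0 ?enorm_ge0// lerD// ediam_ub.
apply: measurable_continuous_on => -[x y] e [/= Ox Oy] e0.
have [s s0 sP] := modulus_small om e0.
have [t t0 tP] := @enorm_ball R d (s / 2) (divr_gt0 s0 (ltr0n _ 2)).
exists t => // -[x' y'] [/= Ox' Oy'] xx' yy'.
apply: le_lt_trans (c_modulus Ox Ox' Oy Oy') _; apply: sP.
  by rewrite addr_ge0// enorm_ge0.
by rewrite [ltRHS]splitr ltrD// tP.
Qed.

End bounded_data.

Section radius.
Context (R : realType) (d : nat).
Local Notation Rd := 'rV[R]_d.
Variables (A B : set Rd) (omega : R -> R) (eps : R).
Hypotheses (om : modulus omega) (eps_gt0 : 0 < eps).

Let E := [set r | 0 <= r <= scale_bound A B /\
  2 * omega r + omega (2 * r) <= eps / 2].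

Let hE : has_sup E.
Proof.
split.
  exists 0; split; first by rewrite lexx /= /scale_bound le_max ler01.
  by case: om => _ _ _ o0; rewrite mulr0 o0 mulr0 addr0 divr_ge0 // ltW.
by exists (scale_bound A B) => r [/andP[]].
Qed.

Lemma varrho_gt0 : 0 < varrho A B omega eps.
Proof.
have e4 : 0 < eps / 8 by rewrite divr_gt0.
have [s s0 sP] := modulus_small om e4.
pose t := Num.min 1 (s / 4).
have t0 : 0 < t by rewrite lt_min ltr01 divr_gt0.
have ts : t <= s / 4 by rewrite /t ge_min lexx orbT.
apply: (lt_le_trans t0); apply: ub_le_sup; first by case: hE.
split; first by rewrite (ltW t0) /= /scale_bound le_max ge_min lexx.
have h1 : omega t < eps / 8 by apply: sP; [exact: ltW|lra].
have h2 : omega (2 * t) < eps / 8 by apply: sP; lra.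
lra.
Qed.

(** The constraint defining the radius is closed, so the supremum satisfies it. *)
Lemma varrho_bound :
  2 * omega (varrho A B omega eps) + omega (2 * varrho A B omega eps) <= eps / 2.
Proof.
set r := varrho A B omega eps; have r0 : 0 < r by exact: varrho_gt0.
apply/ler_addgt0Pr => e e0.
have e3 : 0 < e / 3 by rewrite divr_gt0.
have [s1 s10 s1P] := modulus_cvg om (ltW r0) e3.
have r20 : 0 <= 2 * r by rewrite mulr_ge0// ltW.
have [s2 s20 s2P] := modulus_cvg om r20 e3.
have s0 : 0 < Num.min s1 (s2 / 2) by rewrite lt_min s10 divr_gt0.
have [t Et rt] := sup_adherent s0 hE.
have tr : t <= r by apply: ub_le_sup => //; case: hE.
case: Et => /andP[t0 _] et.
have tmin : r - t < Num.min s1 (s2 / 2) by rewrite ltrBlDr -ltrBlDl; exact: rt.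
move: tmin; rewrite lt_min => /andP[t1 t2].
have := s1P t t0; rewrite ger0_norm ?subr_ge0// => /(_ t1).
rewrite ltr_norml => /andP[_ h1].
have t20 : 0 <= 2 * t by rewrite mulr_ge0.
have := s2P (2 * t) t20; rewrite ger0_norm; last by lra.
move=> /(_ ltac:(lra)); rewrite ltr_norml => /andP[_ h2].
lra.
Qed.

End radius.

Section ball_mass.
Context (R : realType) (d : nat).
Local Notation Rd := 'rV[R]_d.
Variable (Q : probability Rd R).

Lemma fine_probability_le (A B : set Rd) : measurable A -> measurable B ->
  A `<=` B -> fine (Q A) <= fine (Q B).
Proof.
move=> mA mB AB; rewrite fine_le ?fin_num_measure//.
by apply: le_measure; rewrite ?inE.
Qed.

Lemma fine_probability_gt0 (A : set Rd) (y : Rd) : open A -> A y ->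
  msupport Q y -> 0 < fine (Q A).
Proof.
move=> oA Ay Sy; rewrite -lte_fin fineK; first exact: Sy.
by rewrite fin_num_measure//; exact: open_measurable_rV.
Qed.

Lemma fine_probability_le1 (A : set Rd) : measurable A -> fine (Q A) <= 1.
Proof.
by move=> mA; rewrite -lee_fin fineK ?probability_le1// fin_num_measure.
Qed.

Let positive_min (h : Rd -> R) (s : seq Rd) : (forall i, i \in s -> 0 < h i) ->
  exists2 m : R, 0 < m & forall i, i \in s -> m <= h i.
Proof.
elim: s => [|a s ih] hs; first by exists 1.
have [i si|m m0 mP] := ih; first by apply: hs; rewrite inE si orbT.
exists (Num.min m (h a)); first by rewrite lt_min m0 hs// mem_head.
by move=> i; rewrite inE ge_min => /predU1P[->|/mP ->//]; rewrite lexx orbT.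
Qed.

(** Finitely many small balls centered in the support cover it, and each point of
the support has one of them inside its ball of radius [r]. *)
Lemma ball_mass_inf_gt0 (r : R) : compact (msupport Q) -> 0 < r ->
  0 < inf [set fine (Q (eball y r)) | y in msupport Q].
Proof.
move=> cQ r0; have [s s0 sP] := @enorm_ball R d r r0.
have s20 : 0 < s / 2 by rewrite divr_gt0.
move: cQ; rewrite compact_cover => cov.
have [||F FQ QF] := cov Rd (msupport Q) (fun y => ball y (s / 2)).
- by move=> i _; exact: ball_open.
- by move=> y Sy; exists y => //; exact: ballxx.
have [|m m0 mP] := @positive_min (fun y => fine (Q (ball y (s / 2))))
  (finmap.enum_fset F).
  move=> i iF; apply: (fine_probability_gt0 (y := i)); [exact: ball_open|exact:
    ballxx|].
  exact: set_mem (FQ _ iF).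
apply: (lt_le_trans m0); apply: lb_le_inf.
  by have [y Sy] := msupport_nonempty Q; exists (fine (Q (eball y r))), y.
move=> _ [y Sy <-]; have [i /= iF iy] := QF y Sy.
apply: le_trans (mP i iF) _; apply: fine_probability_le.
- by apply: open_measurable_rV; exact: ball_open.
- exact: measurable_eball.
move=> z iz; rewrite /eball /= -enormN opprB; apply: sP.
rewrite [s]splitr; apply: (ball_triangle _ iz); exact: ball_sym.
Qed.

Lemma ball_mass_inf_le (r : R) (y : Rd) : msupport Q y ->
  inf [set fine (Q (eball y r)) | y in msupport Q] <= fine (Q (eball y r)).
Proof.
move=> Sy; apply: ge_inf; last by exists y.
by exists 0 => _ [z _ <-]; rewrite fine_ge0.
Qed.

End ball_mass.

(** * Proof of the theorem *)

Section potentials.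
Context (R : realType) (d : nat).
Local Notation Rd := 'rV[R]_d.
Variables (P Q : probability Rd R) (c : Rd -> Rd -> R) (omega : R -> R) (eps : R).
Local Notation Om := (msupport P).
Local Notation Om' := (msupport Q).
Local Notation S := (Om `*` Om').
Hypotheses (eps_gt0 : 0 < eps) (om : modulus omega)
  (bc : bmeas S (fun z => c z.1 z.2)) (c_modulus : cost_modulus Om Om' c omega).
Variables (fs gs : Rd -> R).
Hypotheses (bfs : bmeas Om fs) (bgs : bmeas Om' gs)
  (fs_modulus : has_modulus Om fs omega) (gs_modulus : has_modulus Om' gs omega)
  (potentials : dual_maximizer P Q c eps fs gs).

Let mO : measurable Om := measurable_msupport P.
Let mO' : measurable Om' := measurable_msupport Q.

Lemma slack_modulus x x' y y' : Om x -> Om x' -> Om' y -> Om' y' ->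
  `|slack c fs gs (x, y) - slack c fs gs (x', y')| <=
  omega (enorm (x - x')) + omega (enorm (y - y')) +
  omega (enorm (x - x') + enorm (y - y')).
Proof.
move=> Ox Ox' Oy Oy'.
have -> : slack c fs gs (x, y) - slack c fs gs (x', y') =
  (fs x - fs x') + (gs y - gs y') + - (c x y - c x' y').
  by rewrite /slack /=; ring.
rewrite (le_trans (ler_normD _ _))// lerD//; last by rewrite normrN; exact: c_modulus.
by rewrite (le_trans (ler_normD _ _))// lerD//; [exact: fs_modulus|exact: gs_modulus].
Qed.

Lemma row_slack_ge x : Om x ->
  exists2 y, Om' y & eps <= slack c fs gs (x, y).
Proof.
move=> Ox; have bs := bmeas_slack bc bfs bgs.
apply: (exists_slack_ge eps_gt0 bs) => // [x0 e Ox0 e0|a ba].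
  have [s s0 sP] := modulus_small om (divr_gt0 e0 (ltr0n _ 2)).
  exists s => // x1 y Ox1 Oy xs.
  apply: le_trans (slack_modulus Ox1 Ox0 Oy Oy) _.
  have h := sP _ (enorm_ge0 _) xs; case: om => _ _ _ o0.
  by rewrite subrr enorm0 o0 !addr0; lra.
have b0 : bmeas Om' (fun=> 0 : R) by exact: bmeas_cst.
have := first_order eps_gt0 bc bfs bgs potentials ba b0.
rewrite (residual_pairing eps bc bfs bgs ba b0) [X in _ + X](_ : _ = 0); last first.
  by rewrite -[RHS](int_cst mO' (probability_msupport Q) 0); apply: eq_int => y
    _; rewrite mul0r.
rewrite addr0 => h; rewrite -[RHS]h; apply: eq_int => x1 Ox1.
by rewrite (D1GammaE _ bc).
Qed.

Lemma column_slack_ge y : Om' y ->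
  exists2 x, Om x & eps <= slack c fs gs (x, y).
Proof.
move=> Oy; have bs := bmeas_swap mO mO' (bmeas_slack bc bfs bgs).
apply: (exists_slack_ge eps_gt0 bs) => // [y0 e Oy0 e0|b bb].
  have [s s0 sP] := modulus_small om (divr_gt0 e0 (ltr0n _ 2)).
  exists s => // y1 x Oy1 Ox ys.
  apply: le_trans (slack_modulus Ox Ox Oy1 Oy0) _.
  have h := sP _ (enorm_ge0 _) ys; case: om => _ _ _ o0.
  by rewrite subrr enorm0 o0 !add0r; lra.
have b0 : bmeas Om (fun=> 0 : R) by exact: bmeas_cst.
have := first_order eps_gt0 bc bfs bgs potentials b0 bb.
rewrite (residual_pairing eps bc bfs bgs b0 bb) [X in X + _](_ : _ = 0); last first.
  by rewrite -[RHS](int_cst mO (probability_msupport P) 0); apply: eq_int => x _;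
    rewrite mul0r.
rewrite add0r => h; rewrite -[RHS]h; apply: eq_int => y1 Oy1.
by rewrite (D2GammaE _ bc).
Qed.

(** A slack of [eps] at one point leaves [eps / 2] on the balls of radius [r]. *)
Lemma slack_near (r : R) x x' y y' : 0 <= r ->
  2 * omega r + omega (2 * r) <= eps / 2 ->
  Om x -> Om x' -> Om' y -> Om' y' -> enorm (x' - x) <= r -> enorm (y' - y) <= r ->
  eps <= slack c fs gs (x, y) -> eps / 2 <= slack c fs gs (x', y').
Proof.
move=> r0 hr Ox Ox' Oy Oy' xr yr h.
have := slack_modulus Ox' Ox Oy' Oy; case: om => _ mon _ _.
have h1 := mon _ _ (enorm_ge0 _) xr; have h2 := mon _ _ (enorm_ge0 _) yr.
have h3 : omega (enorm (x' - x) + enorm (y' - y)) <= omega (2 * r).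
  by apply: mon; rewrite ?addr_ge0 ?enorm_ge0// mulr_natl mulr2n lerD.
by rewrite ler_norml => /andP[]; lra.
Qed.

End potentials.

Section pair_norm_bounded.
Context (R : realType) (d : nat).
Local Notation Rd := 'rV[R]_d.
Variables (P Q : probability Rd R).

Lemma pair_normE (a b : Rd -> R) : bmeas (msupport P) a -> bmeas (msupport Q) b ->
  pair_norm P Q a b = (Num.sqrt (\int[P]_(x in msupport P) (a x ^+ 2) +
    \int[Q]_(y in msupport Q) (b y ^+ 2)))%:E.
Proof.
move=> ba bb; rewrite /pair_norm.
rewrite (L2norm_bmeas P (measurable_msupport P) ba) (L2norm_bmeas Q
  (measurable_msupport Q) bb).
have A0 : 0 <= \int[P]_(x in msupport P) (a x ^+ 2) by apply: Rintegral_ge0 => x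
  _; exact: sqr_ge0.
have B0 : 0 <= \int[Q]_(x in msupport Q) (b x ^+ 2) by apply: Rintegral_ge0 => x
  _; exact: sqr_ge0.
rewrite -!EFin_expe !sqr_sqrtr// -EFinD poweR_EFin powR12_sqrt//.
by rewrite addr_ge0.
Qed.

End pair_norm_bounded.

Theorem corollaryA7 (R : realType) (d : nat) (d_ge1 : (1 <= d)%N)
    (eps : R) (eps_gt0 : 0 < eps)
    (P Q : probability 'rV[R]_d R)
    (P_convex : convex_set (msupport P)) (P_compact : compact (msupport P))
    (rho : 'rV[R]_d -> R) (P_density : is_density P rho)
    (lambda Lambda : R) (lambda_gt0 : 0 < lambda)
    (lambda_lt_Lambda : lambda < Lambda)
    (rho_bounds : forall x, msupport P x -> lambda <= rho x <= Lambda)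
    (Q_compact : compact (msupport Q))
    (c : 'rV[R]_d -> 'rV[R]_d -> R) (omega : R -> R)
    (omega_modulus : modulus omega)
    (c_modulus : cost_modulus (msupport P) (msupport Q) c omega)
    (delta : R) (delta_gt0 : 0 < delta) (delta_le1 : delta <= 1)
    (P_eball : forall (x : 'rV[R]_d) (r : R), msupport P x -> 0 < r ->
       ((delta * Num.min (r ^+ d) 1)%:E <= P (eball x r))%E)
    (fs gs : 'rV[R]_d -> R)
    (potentials : dual_maximizer P Q c eps fs gs)
    (fs_modulus : has_modulus (msupport P) fs omega)
    (gs_modulus : has_modulus (msupport Q) gs omega)
    (f g : 'rV[R]_d -> R)
    (f_Loo : Loofun (msupport P) f) (g_Loo : Loofun (msupport Q) g) :
  let D := osum f g \- osum fs gs in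
  let DGamma := pair_norm P Q (D1Gamma Q c eps f g) (D2Gamma P c eps f g) in
  let K := gamma_const P Q omega eps lambda Lambda delta *
           Num.max (supnorm (prod_supp P Q) D) eps in
  (L2norm (prodP P Q) (prod_supp P Q) D <= K%:E * DGamma)%E /\
  ((QOT P Q c eps - (Gamma P Q c eps f g)%:E) / K%:E <= DGamma ^+ 2)%E.
Proof.
move=> D DGamma K.
have mO := measurable_msupport P; have mO' := measurable_msupport Q.
have mS : measurable (msupport P `*` msupport Q) by exact: measurableX.
have bf := Loofun_bmeas f_Loo; have bg := Loofun_bmeas g_Loo.
have bc := cost_bmeas P_compact Q_compact omega_modulus c_modulus.
have bfs : bmeas (msupport P) fs.
  apply: (modulus_bmeas P_compact (msupport_nonempty P) omega_modulus) => //.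
  by case: potentials => -[].
have bgs : bmeas (msupport Q) gs.
  apply: (modulus_bmeas Q_compact (msupport_nonempty Q) omega_modulus) => //.
  by case: potentials => _ [].
have stationary := first_order eps_gt0 bc bfs bgs potentials.
pose r := varrho (msupport P) (msupport Q) omega eps.
have r0 : 0 < r by exact: varrho_gt0.
have r_slack : 2 * omega r + omega (2 * r) <= eps / 2 by exact: varrho_bound.
pose q := inf [set fine (Q (eball y r)) | y in msupport Q].
have q0 : 0 < q by exact: ball_mass_inf_gt0.
have q_le y : msupport Q y -> q <= fine (Q (eball y r)) by exact: ball_mass_inf_le.
have q1 : q <= 1.
  have [y Sy] := msupport_nonempty Q; apply: (le_trans (q_le y Sy)).
  by apply: fine_probability_le1; exact: measurable_eball.
have diam0 := ediam_gt0 P_density rho_bounds d_ge1 P_compact.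
(* The number of steps is the ceiling in the constant; it is positive because the
   diameter is. *)
have [N N0 NE] : exists2 N : nat, (0 < N)%N &
    (Num.ceil (ediam (msupport P) / r))%:~R = N%:R :> R.
  have h : 0 < Num.ceil (ediam (msupport P) / r) by rewrite ceil_gt0 divr_gt0.
  case: (Num.ceil _) h => // N h; exists N => //.
have N_diam x x' : msupport P x -> msupport P x' -> enorm (x - x') <= N%:R * r.
  move=> Ox Ox'; apply: le_trans (ediam_ub P_compact Ox Ox') _.
  by rewrite -ler_pdivrMr// -NE ceil_ge.
pose m := Num.min r 1.
have m0 : 0 < m by rewrite lt_min r0 ltr01.
have m1 : m <= 1 by rewrite ge_min lexx orbT.
pose p := delta * m ^+ d.
have p0 : 0 < p by rewrite mulr_gt0// exprn_gt0.
have p1 : p <= 1 by rewrite mulr_ile1 ?exprn_ile1 ?exprn_ge0 ?(ltW m0) ?(ltW delta_gt0).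
have P_ball x : msupport P x -> p <= fine (P (eball x r)).
  move=> Ox; rewrite -lee_fin fineK ?fin_num_measure//; last exact: measurable_eball.
  apply: le_trans (P_eball x r Ox r0); rewrite lee_fin ler_wpM2l ?(ltW delta_gt0)//.
  by rewrite le_min exprn_ile1 ?(ltW m0)// andbT lerXn2r ?nnegrE ?(ltW m0) ?(ltW
    r0)// ge_min lexx.
have bs := bmeas_slack bc bfs bgs.
pose E := (msupport P `*` msupport Q) `&` slack c fs gs @^-1` `[eps / 2, +oo[.
have mE : measurable E by case: bs => ms _; apply: ms.
pose w : 'rV[R]_d * 'rV[R]_d -> R := \1_E.
have bw : bmeas (msupport P `*` msupport Q) w by exact: bmeas_indic.
have w1 x y : msupport P x -> msupport Q y -> eps / 2 <= slack c fs gs (x, y) ->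
  w (x, y) = 1.
  move=> Ox Oy h; rewrite /w indicE mem_set//; split => //=.
  by rewrite in_itv /= h.
have w_ge0 z : 0 <= w z by rewrite /w indicE.
have w_slack z : (msupport P `*` msupport Q) z ->
    w z = 0 \/ w z = 1 /\ eps / 2 <= slack c fs gs z.
  move=> _; rewrite /w indicE; case: (boolP (z \in E)) => [/set_mem[_ /=]|_];
    last by left.
  by rewrite in_itv /= andbT; right.
have w_row x : msupport P x -> exists2 y0, msupport Q y0 & forall x' y,
     msupport P x' -> msupport Q y -> enorm (x' - x) <= r -> eball y0 r y -> w
       (x', y) = 1.
  move=> Ox; have [y0 Oy0 h] := row_slack_ge eps_gt0 omega_modulus bc c_modulus
    bfs bgs fs_modulus gs_modulus potentials Ox.
  exists y0 => // x' y Ox' Oy xr yr; apply: w1 => //.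
  by apply: (slack_near omega_modulus c_modulus fs_modulus gs_modulus (ltW r0)
    r_slack Ox Ox' Oy0 Oy xr (ltW yr)).
have w_col y : msupport Q y -> exists2 x0, msupport P x0 & forall x,
     msupport P x -> eball x0 r x -> w (x, y) = 1.
  move=> Oy; have [x0 Ox0 h] := column_slack_ge eps_gt0 omega_modulus bc
    c_modulus bfs bgs fs_modulus gs_modulus potentials Oy.
  exists x0 => // x Ox xr; apply: w1 => //.
  apply: (slack_near omega_modulus c_modulus fs_modulus gs_modulus (ltW r0)
    r_slack Ox0 Ox Oy Oy (ltW xr) _ h).
  by rewrite subrr enorm0 ltW.
pose gam := gamma_const P Q omega eps lambda Lambda delta.
have L0 : 0 < Lambda by exact: lt_trans lambda_lt_Lambda.
have L1 : 1 <= Lambda / lambda by rewrite ler_pdivlMr// mul1r ltW.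
(* The constant of [poincare_osum]; the constant of the theorem carries one more
   factor [Lambda / lambda >= 1]. *)
pose A := 8 * (p * q)^-1 * (N%:R ^+ 2 * (N%:R ^+ d * (Lambda / lambda))).
have A0 : 0 < A.
  by rewrite /A !mulr_gt0 ?invr_gt0 ?mulr_gt0 ?exprn_gt0 ?ltr0n.
have gamE : gam = 2 * (A * (Lambda / lambda)).
  rewrite /gam /gamma_const /= -/r -/q -/m NE /A /p exprD.
  by field; rewrite !gt_eqF ?exprn_gt0.
have gam0 : 0 < gam by rewrite gamE mulr_gt0// mulr_gt0// (lt_le_trans _ L1).
have C0 : 0 < gam / 2 by rewrite divr_gt0.
have poincare u v : bmeas (msupport P) u -> bmeas (msupport Q) v ->
    \int[P]_(x in msupport P) u x = 0 ->
    \int[(P \x Q)%E]_(z in msupport P `*` msupport Q) (u z.1 + v z.2) ^+ 2 <=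
    gam / 2 * \int[(P \x Q)%E]_(z in msupport P `*` msupport Q) (w z * (u z.1 + v
      z.2) ^+ 2).
  move=> bu bv u0; apply: le_trans (poincare_osum P_convex P_density lambda_gt0
    rho_bounds bu bv bw w_ge0 (ltW r0) N0 N_diam p0 p1 q0 q1 P_ball q_le w_row
      w_col u0) _.
  rewrite ler_wpM2r//.
    by apply: Rintegral_ge0 => z _; rewrite mulr_ge0// sqr_ge0.
  by rewrite gamE -/A [2 * (A * _)]mulrC mulfK ?pnatr_eq0// ler_peMr// ltW.
have DE z : D z = (f z.1 - fs z.1) + (g z.2 - gs z.2).
  by rewrite /D /osum /=; ring.
have bD : bmeas (msupport P `*` msupport Q) D.
  by apply: (eq_bmeas (fun z _ => esym (DE z))); bmeas_auto.
pose M := Num.max (supnorm (prod_supp P Q) D) eps.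
have M_eps : eps <= M by rewrite le_max lexx orbT.
have M_bound z : (msupport P `*` msupport Q) z ->
    `|(f z.1 - fs z.1) + (g z.2 - gs z.2)| <= M.
  move=> Sz; rewrite -DE le_max; apply/orP; left.
  apply: ub_le_sup; last by exists z.
  by have [_ [B DB]] := bD; exists B => _ [z' Sz' <-]; exact: DB.
have M0 : 0 < M by exact: lt_le_trans M_eps.
have KE : 2 * M * (gam / 2) = K.
  have half (a b : R) : 2 * a * (b / 2) = b * a by field.
  exact: half.
have K0 : 0 < K by exact: mulr_gt0.
have b1 := bmeas_D1Gamma eps bc bf bg.
have b2 := bmeas_D2Gamma eps bc bf bg.
have := distance_le_gradient eps_gt0 bc bfs bgs bf bg bw stationary M_eps M_bound
  w_slack C0 poincare.
have := gap_le_gradient eps_gt0 bc bfs bgs bf bg bw stationary M_eps M_bound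
  w_slack C0 poincare.
rewrite KE.
have -> : DGamma = (Num.sqrt (\int[P]_(x in msupport P) (D1Gamma Q c eps f g x ^+ 2) +
    \int[Q]_(y in msupport Q) (D2Gamma P c eps f g y ^+ 2)))%:E.
  exact: pair_normE.
have : 0 <= \int[P]_(x in msupport P) (D1Gamma Q c eps f g x ^+ 2) +
    \int[Q]_(y in msupport Q) (D2Gamma P c eps f g y ^+ 2).
  by rewrite addr_ge0// Rintegral_ge0// => z _; exact: sqr_ge0.
move: (\int[P]_(x in msupport P) (D1Gamma Q c eps f g x ^+ 2) +
    \int[Q]_(y in msupport Q) (D2Gamma P c eps f g y ^+ 2)) => m2 m20 gap norm.
split.
  rewrite /prod_supp (L2norm_bmeas (prodP P Q) mS bD) -EFinM lee_fin.
  rewrite -[K]gtr0_norm// -sqrtr_sqr -sqrtrM ?sqr_ge0// ler_wsqrtr//.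
  by apply: le_trans norm; rewrite le_eqVlt; apply/orP; left; apply/eqP;
    apply: eq_int => z _; rewrite DE.
rewrite inver gt_eqF// lee_pdivrMr// -EFin_expe sqr_sqrtr//.
rewrite leeBlDr// -EFinM -EFinD.
apply: le_trans (QOT_le_Gamma eps_gt0 bc bfs bgs stationary) _.
by rewrite lee_fin -lerBlDr mulrC.
Qed.
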